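(* Let $H^+=\{z\in\mathbb{C}:\operatorname{Im}(z)>0\}$ and $X=H^+\times SL_2(\mathbb{C})$. There exists a properly discontinuous and free action $\mu$ of the free group $F_2$ with two generators on the complex manifold $X$ by biholomorphic automorphisms such that the quotient complex manifold $Y=X/\mu$ satisfies $d_Y\equiv 0$, where $d_Y$ denotes the Kobayashi pseudodistance of $Y$.
   Context: Complex manifolds are assumed connected. Let $\Delta=\{z\in\mathbb{C}:|z|<1\}$ be the unit disc and let $d_\Delta$ be the Poincaré distance on $\Delta$. For a complex manifold $Y$ and $p,q\in Y$, the Kobayashi pseudodistance $d_Y(p,q)$ is the infimum of $\sum_{i=1}^k d_\Delta(a_i,b_i)$ over all chains of discs from $p$ to $q$, i.e. over all $k\ge 1$, points $p=p_0,p_1,\dots,p_k=q$ of $Y$, points $a_i,b_i\in\Delta$ and holomorphic maps $f_i:\Delta\to Y$ with $f_i(a_i)=p_{i-1}$ and $f_i(b_i)=p_i$. The notation $d_Y\equiv 0$ means $d_Y(p,q)=0$ for all $p,q\in Y$. *)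

(* Defs.v *)
From HB Require Import structures.
From mathcomp Require Import all_boot all_order all_algebra.
From mathcomp Require Import complex.
From mathcomp Require Import all_classical all_reals all_analysis.

Set Implicit Arguments.
Unset Strict Implicit.
Unset Printing Implicit Defensive.

Import Order.TTheory GRing.Theory Num.Theory.
Import numFieldNormedType.Exports.

Local Open Scope classical_set_scope.
Local Open Scope ring_scope.
Local Open Scope quotient_scope.

(* MathComp-Analysis only puts a topology on the alias R[i]^o; it is that of   *)
(* the modulus. Differentiability over the scalars R[i] is complex             *)
(* differentiability.                                                          *)
HB.instance Definition _ (R : rcfType) := PseudoPointedMetric.copy R[i] R[i]^o.
HB.instance Definition _ (R : rcfType) := NormedModule.copy R[i] R[i]^o.

(* The values of cmap outside cdom are irrelevant.                             *)
Record chart (R : realType) (n : nat) (T : Type) := Chart {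
  cdom : set T;
  cmap : T -> 'rV[R[i]]_n }.

(* The inverse cmap @` cdom -> cdom of an injective chart; p is the junk value *)
(* taken elsewhere.                                                            *)
Definition chart_inv (R : realType) n (T : choiceType) (c : chart R n T) (p : T)
    (v : 'rV[R[i]]_n) : T :=
  xget p [set x | cdom c x /\ cmap c x = v].

Record charted (R : realType) (n : nat) := Charted {
  carrier :> topologicalType;
  atlas : set (chart R n carrier) }.
Arguments atlas {R n} M : rename.

Definition homeo_chart (R : realType) n (T : topologicalType)
    (c : chart R n T) : Prop :=
  [/\ open (cdom c),
      set_inj (cdom c) (cmap c),
      forall p, cdom c p -> {for p, continuous (cmap c)} &
      forall U, open U -> U `<=` cdom c -> open (cmap c @` U)].

Definition complex_manifold (R : realType) n (M : charted R n) : Prop :=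
  [/\ [/\ hausdorff_space M, @second_countable M & connected [set: M]],
      forall c, atlas M c -> homeo_chart c,
      forall p : M, exists2 c, atlas M c & cdom c p &
      forall c d p, atlas M c -> atlas M d -> cdom c p -> cdom d p ->
        differentiable (cmap d \o chart_inv c p) (cmap c p)].

Definition holomorphic (R : realType) m n (M : charted R m) (N : charted R n)
    (f : M -> N) : Prop :=
  continuous f /\
  forall c d p, atlas M c -> atlas N d -> cdom c p -> cdom d (f p) ->
    differentiable (cmap d \o f \o chart_inv c p) (cmap c p).

Definition biholomorphic (R : realType) m n (M : charted R m)
    (N : charted R n) (f : M -> N) : Prop :=
  holomorphic f /\
  exists g : N -> M, [/\ holomorphic g, cancel f g & cancel g f].

(* A is meant to be open.                                                      *)
Definition plane_domain (R : realType) (A : set R[i]) : charted R 1 :=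
  @Charted R 1 (set_type A) [set Chart setT (fun z => const_mx (set_val z))].

Definition product_manifold (R : realType) m n (M : charted R m)
    (N : charted R n) : charted R (m + n) :=
  @Charted R (m + n) (M * N)%type
    [set Chart (cdom c `*` cdom d)
               (fun p => row_mx (cmap c p.1) (cmap d p.2))
    | c in atlas M & d in atlas N].

Definition unit_disc (R : realType) : charted R 1 :=
  plane_domain [set z : R[i] | `|z| < 1].

(* Curvature -1 normalisation, i.e. the distance of 2 |dz| / (1 - |z|^2).      *)
(* Re only casts the modulus from R[i] to R.                                   *)
Definition poincare_dist (R : realType) (a b : unit_disc R) : R :=
  let z : R[i] := set_val a in
  let w : R[i] := set_val b in
  let r : R := complex.Re `|(z - w) / (1 - conjc z * w)| in
  ln ((1 + r) / (1 - r)).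

Definition disc_chain (R : realType) n (Y : charted R n) (p q : Y) (k : nat)
    (P : nat -> Y) (a b : nat -> unit_disc R)
    (f : nat -> unit_disc R -> Y) : Prop :=
  [/\ (0 < k)%N, P 0 = p, P k = q &
      forall i, (i < k)%N ->
        [/\ holomorphic (f i), f i (a i) = P i & f i (b i) = P i.+1]].

Definition kobayashi (R : realType) n (Y : charted R n) (p q : Y) : \bar R :=
  ereal_inf [set l | exists k P a b f, @disc_chain R n Y p q k P a b f /\
                       l = (\sum_(i < k) poincare_dist (a i) (b i))%:E].

Record group_action (G : groupType) (T : Type) := GroupAction {
  act :> G -> T -> T;
  act1 : forall x, act 1%g x = x;
  actM : forall g h x, act (g * h)%g x = act g (act h x) }.

Definition free_action (G : groupType) (T : Type) (mu : group_action G T) :=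
  forall g x, mu g x = x -> g = 1%g.

Definition properly_discontinuous (G : groupType) (T : topologicalType)
    (mu : group_action G T) : Prop :=
  forall K : set T, compact K -> finite_set [set g | mu g @` K `&` K !=set0].

Section quotient.
Variables (G : groupType) (T : topologicalType) (mu : group_action G T).

Definition orbit_rel (x y : T) : bool := `[< exists g, mu g x = y >].

Lemma orbit_rel_refl : reflexive orbit_rel.
Proof. by move=> x; apply/asboolP; exists 1%g; exact: act1. Qed.

Lemma orbit_rel_sym : symmetric orbit_rel.
Proof.
move=> x y; apply/asboolP/asboolP => -[g <-]; exists g^-1%g;
by rewrite -actM mulVg act1.
Qed.

Lemma orbit_rel_trans : transitive orbit_rel.
Proof.
move=> y x z /asboolP[g <-] /asboolP[h <-]; apply/asboolP.
by exists (h * g)%g; rewrite actM.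
Qed.

Canonical orbit_equiv :=
  EquivRel orbit_rel orbit_rel_refl orbit_rel_sym orbit_rel_trans.

Definition quotient_space : topologicalType :=
  quotient_topology {eq_quot orbit_equiv}.

Definition quotient_proj (x : T) : quotient_space :=
  (\pi_(quotient_topology {eq_quot orbit_equiv}) x)%qT.

End quotient.

(* The charts are the d \o (proj|U)^-1, where d is a chart of M and U is an    *)
(* open subset of its domain which proj maps injectively to the quotient.      *)
Definition quotient_manifold (R : realType) n (G : groupType)
    (M : charted R n) (mu : group_action G M) : charted R n :=
  @Charted R n (quotient_space mu)
    [set c | exists d U,
      [/\ atlas M d, open U, U `<=` cdom d, set_inj U (quotient_proj mu) &
          cdom c = quotient_proj mu @` U /\
          forall x, U x -> cmap c (quotient_proj mu x) = cmap d x]].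

(* The free group on T: reduced words in the letters x^{+1}, x^{-1}, written   *)
(* (x, true) and (x, false); the product is concatenation followed by          *)
(* reduction.                                                                  *)

Section free_group.
Variable T : choiceType.
Local Notation letter := (T * bool)%type.

Definition letter_inv (x : letter) : letter := (x.1, ~~ x.2).

Definition reduced : pred (seq letter) :=
  sorted (fun x y => y != letter_inv x).

Definition push (x : letter) (w : seq letter) : seq letter :=
  if w is y :: w' then if y == letter_inv x then w' else x :: w else [:: x].

Definition free_group : Type := {w : seq letter | reduced w}.
HB.instance Definition _ := Choice.on free_group.

Lemma letter_invK : involutive letter_inv.
Proof. by case=> x b; rewrite /letter_inv negbK. Qed.

Lemma letter_inv_neq x : letter_inv x != x.
Proof. by case: x => x []; apply/eqP => -[]. Qed.

Lemma reduced_push x w : reduced w -> reduced (push x w).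
Proof.
case: w => [|y w] //= rw; case: ifPn => [_|ne]; first exact: path_sorted rw.
by rewrite /reduced /= ne.
Qed.

Lemma reduced_mul u v : reduced v -> reduced (foldr push v u).
Proof. by move=> rv; elim: u => //= x u; exact: reduced_push. Qed.

Lemma push_push x w : reduced w -> push x (push (letter_inv x) w) = w.
Proof.
case: w => [|y w] /=; first by rewrite eqxx.
rewrite letter_invK; have [->|ne] := eqVneq y x => rw; last by rewrite /= eqxx.
by case: w rw => [|z w] //= /andP[/negPf-> _].
Qed.

Lemma push_mul x u w : reduced u -> reduced w ->
  foldr push w (push x u) = push x (foldr push w u).
Proof.
case: u => [|y u] //= ru rw; case: eqP => [->|_] //.
by rewrite push_push // reduced_mul.
Qed.

Lemma mul_nil u : reduced u -> foldr push [::] u = u.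
Proof.
elim: u => //= x u IH ru; rewrite (IH (path_sorted ru)).
by case: u ru {IH} => [|y u] //= /andP[/negPf-> _].
Qed.

Lemma reduced_inv w : reduced w -> reduced (rev (map letter_inv w)).
Proof.
rewrite /reduced rev_sorted sorted_map; apply: sub_sorted => x y /=.
by rewrite letter_invK eq_sym.
Qed.

Lemma mul_invl u w : reduced w ->
  foldr push (foldr push w u) (rev (map letter_inv u)) = w.
Proof.
move=> rw; elim: u => //= x u IH; rewrite rev_cons foldr_rcons.
have := @push_push (letter_inv x); rewrite letter_invK => -> //.
exact: reduced_mul.
Qed.

Definition fg_one : free_group := exist _ [::] isT.
Definition fg_mul (u v : free_group) : free_group :=
  exist _ (foldr push (val v) (val u)) (reduced_mul (val u) (valP v)).
Definition fg_inv (u : free_group) : free_group :=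
  exist _ (rev (map letter_inv (val u))) (reduced_inv (valP u)).

Lemma fg_mul1g : left_id fg_one fg_mul.
Proof. by move=> u; apply: val_inj. Qed.

Lemma fg_mulg1 : right_id fg_one fg_mul.
Proof. by move=> u; apply: val_inj; exact: mul_nil (valP u). Qed.

Lemma fg_mulA : associative fg_mul.
Proof.
move=> [u ru] [v rv] [w rw]; apply: val_inj => /=.
by elim: u ru => //= x u IH /path_sorted/IH->; rewrite push_mul ?reduced_mul.
Qed.

Lemma fg_mulVg : left_inverse fg_one fg_inv fg_mul.
Proof.
move=> u; apply: val_inj => /=.
by rewrite -[X in foldr _ X _](mul_nil (valP u)) mul_invl.
Qed.

Lemma fg_mulgV : right_inverse fg_one fg_inv fg_mul.
Proof.
move=> u; have invK : fg_inv (fg_inv u) = u.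
  apply: val_inj => /=; rewrite map_rev revK -map_comp map_id_in // => x _.
  exact: letter_invK.
by rewrite -{1}invK fg_mulVg.
Qed.

HB.instance Definition _ :=
  isGroup.Build free_group fg_mulA fg_mul1g fg_mulg1 fg_mulVg fg_mulgV.

End free_group.

Definition F2 : groupType := free_group bool.

Definition upper_half_plane (R : realType) : charted R 1 :=
  plane_domain [set z : R[i] | 0 < complex.Im z].

Definition SL2_set (R : realType) : set 'M[R[i]]_2 := [set g | \det g = 1].

(* On {g i j <> 0} the entries other than the one opposite to (i, j) are       *)
(* coordinates, since that entry is determined by them and by det g = 1.       *)
Definition SL2_chart (R : realType) (i j : 'I_2) :
    chart R 3 (set_type (@SL2_set R)) :=
  let mx (g : set_type (@SL2_set R)) : 'M[R[i]]_2 := set_val g in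
  Chart [set g | mx g i j != 0]
        (fun g => \row_(k < 3) [:: mx g i j; mx g i (rev_ord j);
                                   mx g (rev_ord i) j]`_k).

Definition SL2 (R : realType) : charted R 3 :=
  @Charted R 3 (set_type (@SL2_set R))
    [set SL2_chart R ij.1 ij.2 | ij in [set: 'I_2 * 'I_2]].

Definition HxSL2 (R : realType) : charted R (1 + 3) :=
  product_manifold (upper_half_plane R) (SL2 R).

(* Main.v *)
Require Import Defs.
From HB Require Import structures.
From mathcomp Require Import all_boot all_order all_algebra finmap.
From mathcomp Require Import complex.
From mathcomp Require Import all_classical all_reals all_analysis.
From mathcomp Require Import zify ring lra.

Set Implicit Arguments.
Unset Strict Implicit.
Unset Printing Implicit Defensive.

Import Order.TTheory GRing.Theory Num.Theory.
Import numFieldNormedType.Exports.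

Local Open Scope classical_set_scope.
Local Open Scope ring_scope.
Local Open Scope complex_scope.

(** Let F2 act on SL_2(C) by left multiplication through Sanov's embedding in
    SL_2(Z), and on the upper half plane by real affine maps z |-> e^u z + t.
    The first action is free and properly discontinuous because the embedding
    is injective with discrete image, hence so is the diagonal action on the
    product. The affine maps are chosen with dense orbits: the exponents u run
    through Z + Z sqrt 2, and there are arbitrarily small translations.
    Any two points of SL_2(C) are the values at 0 and 1 of a matrix F of
    polynomials of determinant 1 (a product of elementary matrices). So if
    |z' - z| <= s Im z with 0 < s < 1, then
    zeta |-> (z + (z' - z) zeta / s, F (zeta / s)) is a disc through (z, F 0) at
    0 and (z', F 1) at s. Its Poincare length ln ((1 + s) / (1 - s)) is
    arbitrarily small, since by density z' may be replaced by points of its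
    orbit arbitrarily close to z. *)

(** * Free groups, Sanov matrices and curves in SL_2 *)

Section free_group_action.
Variables (T : choiceType) (X : Type) (f : T * bool -> X -> X).
Hypothesis fK : forall l x, f l (f (letter_inv l) x) = x.

(** The universal property of the free group: maps attached to the letters, with inverse letters
    acting by inverse maps, extend to an action of reduced words. *)
Definition word_act (w : free_group T) (x : X) : X := foldr f x (val w).

Lemma word_act1 x : word_act 1%g x = x.
Proof. by []. Qed.

Lemma foldr_push l w x : foldr f x (push l w) = f l (foldr f x w).
Proof.
by case: w => [|k w] //=; case: eqP => [->|] //=; rewrite fK.
Qed.

Lemma word_actM g h x : word_act (g * h)%g x = word_act g (word_act h x).
Proof.
rewrite /word_act /=; elim: (val g) => //= l w IH.
by rewrite foldr_push IH.
Qed.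

Definition free_group_action : group_action (free_group T) X :=
  GroupAction word_act1 word_actM.

End free_group_action.

(** * Sanov's free subgroup of SL_2(Z) *)

Section sanov.

Definition mx22 (K : Type) (a b c d : K) : 'M[K]_2 :=
  \matrix_(i, j) if i == 0 then (if j == 0 then a else b)
                 else (if j == 0 then c else d).

(** The off-diagonal entry is 2 and not 1, since the unipotent matrices with entry 1 generate all of
    SL_2(Z), which is not free. *)
Definition sanov_letter (l : bool * bool) : 'M[int]_2 :=
  let s : int := if l.2 then 2 else -2 in
  if l.1 then mx22 1 s 0 1 else mx22 1 0 s 1.

Definition sanov (w : F2) : 'M[int]_2 :=
  foldr (fun l M => sanov_letter l *m M) 1%:M (val w).

Lemma mx22E (K : Type) (M : 'M[K]_2) :
  M = mx22 (M 0 0) (M 0 1) (M 1 0) (M 1 1).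
Proof.
apply/matrixP => -[[|[|//]] i] [[|[|//]] j]; rewrite mxE /=;
  by congr (M _ _); apply/val_inj.
Qed.

Lemma mul_mx22 (K : pzSemiRingType) (a b c d a' b' c' d' : K) :
  mx22 a b c d *m mx22 a' b' c' d' =
  mx22 (a * a' + b * c') (a * b' + b * d') (c * a' + d * c') (c * b' + d * d').
Proof.
apply/matrixP => -[[|[|//]] i] [[|[|//]] j];
  by rewrite !mxE !big_ord_recl big_ord0 !mxE /= addr0.
Qed.

Lemma mx22_1 (K : pzSemiRingType) : 1%:M = mx22 1 0 0 1 :> 'M[K]_2.
Proof. by apply/matrixP => -[[|[|//]] i] [[|[|//]] j]; rewrite !mxE. Qed.

Lemma det_mx22 (K : comPzRingType) (a b c d : K) :
  \det (mx22 a b c d) = a * d - b * c.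
Proof.
by rewrite (expand_det_row _ 0) !big_ord_recl big_ord0 /cofactor !det_mx11 !mxE
  /= expr0 expr1 mul1r mulN1r addr0 mulrN.
Qed.

Lemma sanov_letterK l : sanov_letter l *m sanov_letter (letter_inv l) = 1%:M.
Proof.
by case: l => -[] []; rewrite /sanov_letter /= mul_mx22 mx22_1; congr mx22.
Qed.

Lemma det_sanov_letter l : \det (sanov_letter l) = 1.
Proof. by case: l => -[] []; rewrite det_mx22. Qed.

Lemma sanovM g h : sanov (g * h)%g = sanov g *m sanov h.
Proof.
have fK k (M : 'M[int]_2) : 
    sanov_letter k *m (sanov_letter (letter_inv k) *m M) = M.
  by rewrite mulmxA sanov_letterK mul1mx.
rewrite /sanov -[LHS]/(word_act (fun l M => sanov_letter l *m M) _ _).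
rewrite (word_actM fK) /word_act; elim: (val g) => [|l u IH] /=.
  by rewrite mul1mx.
by rewrite IH mulmxA.
Qed.

(** The coordinate selected by [l.1] strictly dominates the other in absolute value, and [l.2]
    prescribes the sign of their product. A zero product is allowed, so that the columns of a single
    letter matrix belong to its cone. *)
Definition cone (l : bool * bool) (x y : int) : bool :=
  let: (x, y) := if l.1 then (x, y) else (y, x) in
  let y := if l.2 then y else - y in
  (0 <= y < x) || (x < y <= 0).

(* Ping-pong: the first letter of a reduced word can be read off the cone which
   contains the image of a basis vector. *)
Lemma sanov_cone l w (j : 'I_2) : reduced (l :: w) ->
  let M := foldr (fun l M => sanov_letter l *m M) 1%:M (l :: w) in
  cone l (M 0 j) (M 1 j).
Proof.
elim: w l => [|k w IH] l.
  by move=> _ /=; rewrite mulmx1; case: j l => -[|[|//]] j [[] []];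
    rewrite !mxE.
move=> /andP[kl /(IH k)]; move: kl => /=; set M := sanov_letter k *m _.
(* Reducedness excludes [k = letter_inv l]; the matrix of [l] maps each of the three remaining cones
   into its own. *)
rewrite (mx22E M) /cone; case: l k {IH} M => -[] [] [[] []] M;
  rewrite /sanov_letter /= ?eqxx // => _; rewrite mul_mx22 !mxE /=;
  case: j => -[|[|//]] j /=; lia.
Qed.

(** Both columns of the matrix of a nonempty word lie in the cone of its first letter, and no cone
    contains both basis vectors. *)
Lemma sanov_eq1 w : sanov w = 1%:M -> w = 1%g.
Proof.
case: w => -[|l w] rw; first by move=> _; apply: val_inj.
have := sanov_cone 0 rw; have := sanov_cone 1 rw; rewrite /sanov /= => c1 c0 e.
by exfalso; move: c1 c0; rewrite !e !mxE /=; case: l {rw e} => -[] [].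
Qed.

Lemma sanov_inj : injective sanov.
Proof.
move=> g h e; have : sanov (h^-1 * g)%g = 1%:M.
  by rewrite sanovM e -sanovM mulVg.
by move=> /sanov_eq1 gh; rewrite -[g]mul1g -(mulgV h) -mulgA gh mulg1.
Qed.

End sanov.

(** * Dense subgroups of the real line *)

Section subgroup_density.
Variables (R : realType) (G : set R).
Hypothesis GB : forall x y, G x -> G y -> G (x - y).
Hypothesis G_small : forall e, 0 < e -> exists2 x, G x & 0 < x < e.

Lemma subgroup_mulrz x k : G x -> G (x *~ k).
Proof.
move=> Gx; have G0 : G 0 by rewrite -(subrr x); exact: GB.
have GN y : G y -> G (- y) by rewrite -sub0r; exact: GB.
have GD y z : G y -> G z -> G (y + z).
  by move=> Gy Gz; rewrite -[z]opprK; apply: GB => //; exact: GN.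
have Gn n : G (x *+ n).
  by elim: n => [//|n IH]; rewrite mulrS; exact: GD.
by case: k => n; [exact: Gn|exact/GN/Gn].
Qed.

Lemma subgroup_dense y e : 0 < e -> exists2 x, G x & x <= y < x + e.
Proof.
move=> e0; have [u Gu /andP[u0 ue]] := G_small e0.
(* The largest multiple of [u] not exceeding [y] is at distance less than [u < e] from it. *)
exists (u *~ Num.floor (y / u)); first exact: subgroup_mulrz.
have /andP[fl fu] := floor_itv (y / u).
rewrite -mulrzr mulrC -ler_pdivlMr // fl /=.
apply: lt_trans (_ : (Num.floor (y / u))%:~R * u + u < _); last first.
  by rewrite ltrD2l.
rewrite -[X in _ + X]mul1r -mulrDl -ltr_pdivrMr //.
by move: fu; rewrite intrD.
Qed.

End subgroup_density.

(** * Polynomial curves in SL_2 *)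

Section SL2_curve.
Variable K : fieldType.

(** The product has diagonal entries [1 + x * y] and [1 + y * z] and lower left entry [y], which
    dictates [x], [y], [z]; the upper right entry then agrees because both determinants are 1. *)
Lemma SL2_elementary_neq0 (g : 'M[K]_2) : \det g = 1 -> g 1 0 != 0 ->
  exists x y z, g = mx22 1 x 0 1 *m mx22 1 0 y 1 *m mx22 1 z 0 1.
Proof.
rewrite [g]mx22E det_mx22 mxE /=; move: (g 0 0) (g 0 1) (g 1 0) (g 1 1).
move=> a b c d e c0; exists ((a - 1) / c), c, ((d - 1) / c).
rewrite !mul_mx22; congr mx22; try by field.
have -> : b = (a * d - 1) / c by rewrite -e; field.
by field.
Qed.

(* If the lower left entry vanishes, add the second column to the first. *)
Lemma SL2_elementary (g : 'M[K]_2) : \det g = 1 ->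
  exists x y z t,
    g = mx22 1 x 0 1 *m mx22 1 0 y 1 *m mx22 1 z 0 1 *m mx22 1 0 t 1.
Proof.
move=> dg; have [c0|c0] := eqVneq (g 1 0) 0; last first.
  have [x [y [z ->]]] := SL2_elementary_neq0 dg c0.
  by exists x, y, z, 0; rewrite -[mx22 1 0 0 1]mx22_1 mulmx1.
pose h := g *m mx22 1 0 1 1.
have dh : \det h = 1 by rewrite det_mulmx dg det_mx22 mul0r subr0 !mulr1.
have h0 : h 1 0 != 0.
  move: dg; rewrite /h [g]mx22E mul_mx22 det_mx22 c0 mulr0 subr0 !mxE /= => dg.
  rewrite !mulr1 add0r; apply/eqP => d0; move: dg; rewrite d0 mulr0 => /eqP.
  by rewrite eq_sym oner_eq0.
have [x [y [z e]]] := SL2_elementary_neq0 dh h0.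
exists x, y, z, (-1); rewrite -e /h -mulmxA mul_mx22 -[LHS]mulmx1 mx22_1.
by congr (_ *m mx22 _ _ _ _); ring.
Qed.

(** Factor [invmx g *m h] into elementary matrices and multiply each parameter by the variable:
    every factor keeps determinant 1 and becomes trivial at 0. Polynomial entries make the curve
    usable both as a real path and as a holomorphic map. *)
Lemma SL2_curve (g h : 'M[K]_2) : \det g = 1 -> \det h = 1 ->
  exists F : 'M[{poly K}]_2, [/\ \det F = 1,
    map_mx (horner_eval 0) F = g & map_mx (horner_eval 1) F = h].
Proof.
move=> dg dh; have gV : g \in unitmx by rewrite unitmxE dg unitr1.
have [|x [y [z [t e]]]] := @SL2_elementary (invmx g *m h).
  by rewrite det_mulmx det_inv dg dh invr1 mulr1.
pose E (c : bool) (x : K) : 'M[{poly K}]_2 :=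
  if c then mx22 1 (x *: 'X) 0 1 else mx22 1 0 (x *: 'X) 1.
have detE c u : \det (E c u) = 1.
  by case: c; rewrite det_mx22 ?mulr0 ?mul0r subr0 mulr1.
have evE c u v : map_mx (horner_eval v) (E c u) =
    if c then mx22 1 (u * v) 0 1 else mx22 1 0 (u * v) 1.
  by apply/matrixP => -[[|[|//]] i] [[|[|//]] j]; case: c;
    rewrite !mxE /= /horner_eval ?hornerE.
exists (map_mx polyC g *m (E true x *m E false y *m E true z *m E false t)).
have evC v : map_mx (horner_eval v) (map_mx polyC g) = g.
  by apply/matrixP => i j; rewrite !mxE /horner_eval hornerC.
split.
- by rewrite !det_mulmx !detE !mulr1 det_map_mx dg.
- by rewrite !map_mxM evC !evE !mulr0 -mx22_1 !mulmx1.
- by rewrite !map_mxM evC !evE !mulr1 -e mulKVmx.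
Qed.

End SL2_curve.

(** * Complex differentiability and charts *)

Section differentiable_extra.
Variables (K : numFieldType) (V : normedModType K).

(** The first order expansion of [f] at [x] is also one of [g]. This is used because identities
    involving the inverse of a chart hold only near a point. *)
Lemma near_eq_differentiable (W : normedModType K) (f g : V -> W) x :
  {near x, f =1 g} -> differentiable f x -> differentiable g x.
Proof.
move=> fg df; have [dfc fE] := (diff_locallyP _ _).1 df.
have gE : g \o shift x = cst (g x) + 'd f x +o_ 0 id.
  apply/eqaddoP => e e0; have /eqaddoP/(_ e e0) := fE.
  apply: filter_app; have gx : f x = g x := nbhs_singleton fg.
  move: fg; rewrite (near_shift 0) => fg.
  by apply: filterS fg => h; rewrite /= subr0 !fctE /= -gx => ->.
have dg := diff_unique dfc gE.
by apply/diff_locallyP; rewrite dg.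
Qed.

Lemma differentiable_mx m n (f : V -> 'M[K]_(m, n)) x :
  (forall i j, differentiable (fun v => f v i j) x) -> differentiable f x.
Proof.
move=> df.
have -> : f = \sum_i (\sum_j (fun v => f v i j *: delta_mx i j)).
  apply/funext => v; rewrite fct_sumE [LHS]matrix_sum_delta.
  by apply: eq_bigr => i _; rewrite fct_sumE.
apply: differentiable_sum => i; apply: differentiable_sum => j.
exact: differentiableZl.
Qed.

Lemma differentiable_horner (p : {poly K}) (x : K) :
  differentiable (horner p) x.
Proof.
elim/poly_ind: p => [|p c IH].
  have -> : horner (0 : {poly K}) = cst 0 by apply/funext => y; rewrite horner0.
  exact: differentiable_cst.
have -> : horner (p * 'X + c%:P) = horner p * id + cst c.
  by apply/funext => y; rewrite !hornerE.
by apply: differentiableD => //; apply: differentiableM.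
Qed.

End differentiable_extra.

Section chart_theory.
Variables (R : realType) (n : nat) (T : topologicalType) (c : chart R n T).

Lemma chart_invP p v : (exists2 q, cdom c q & cmap c q = v) ->
  cdom c (chart_inv c p v) /\ cmap c (chart_inv c p v) = v.
Proof.
move=> [q cq qv].
exact: (@xgetPex _ p [set x | cdom c x /\ cmap c x = v]
  (ex_intro _ q (conj cq qv))).
Qed.

Hypothesis hc : homeo_chart c.

Lemma chart_invK p q : cdom c q -> chart_inv c p (cmap c q) = q.
Proof.
case: hc => _ inj _ _ cq; have [|d e] := @chart_invP p (cmap c q).
  by exists q.
by apply: inj => //; exact: mem_set.
Qed.

(** Charts are open maps, so the image of a neighbourhood of [p] inside the domain is a
    neighbourhood of [cmap c p]. This is the continuity of the inverse chart, away from its default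
    value. *)
Lemma chart_inv_nbhs p U : cdom c p -> nbhs p U ->
  \forall v \near cmap c p,
    [/\ U (chart_inv c p v), cdom c (chart_inv c p v) &
        cmap c (chart_inv c p v) = v].
Proof.
case: hc => oc inj _ im cp; rewrite nbhsE => -[V [oV Vp] VU].
have oI : open (cmap c @` (V `&` cdom c)).
  by apply: im; [exact: openI|move=> ? []].
apply: filterS (open_nbhs_nbhs (conj oI _)); last by exists p.
move=> _ [q [Vq cq] <-]; rewrite chart_invK //; split=> //; exact: VU.
Qed.

Lemma chart_inv_near p : cdom c p -> \forall v \near cmap c p,
  cdom c (chart_inv c p v) /\ cmap c (chart_inv c p v) = v.
Proof.
by move=> cp; apply: filterS (chart_inv_nbhs cp filterT) => v [].
Qed.

End chart_theory.

(** An explicit inverse [psi] gives injectivity, and its continuity on the open set [V] makes the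
    chart an open map. *)
Lemma homeo_chart_inv (R : realType) n (T : topologicalType)
    (c : chart R n T) (V : set 'rV[R[i]]_n) (psi : 'rV[R[i]]_n -> T) :
  open (cdom c) -> (forall p, cdom c p -> {for p, continuous (cmap c)}) ->
  open V -> (forall v, V v -> {for v, continuous psi}) ->
  (forall p, cdom c p -> V (cmap c p) /\ psi (cmap c p) = p) ->
  (forall v, V v -> cdom c (psi v) /\ cmap c (psi v) = v) -> homeo_chart c.
Proof.
move=> oc cc oV cpsi ck pk; split=> //.
- move=> p q /set_mem/ck[_ ep] /set_mem/ck[_ eq] e.
  by rewrite -ep -eq e.
- move=> U oU Uc; rewrite openE => _ [p Up <-].
  have [Vp pE] := ck _ (Uc _ Up).
  have : \forall v \near cmap c p, U (psi v).
    by apply: (cpsi _ Vp); rewrite pE; exact: open_nbhs_nbhs.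
  rewrite /interior; apply: filter_app.
  apply: filterS (open_nbhs_nbhs (conj oV Vp)) => v Vv Uv.
  by exists (psi v) => //; have [] := pk _ Vv.
Qed.

Section holomorphic_comp.
Variables (R : realType) (m n k : nat).
Variables (M : charted R m) (N : charted R n) (P : charted R k).
Hypothesis M_homeo : forall c, atlas M c -> homeo_chart c.
Hypothesis N_homeo : forall c, atlas N c -> homeo_chart c.
Hypothesis N_cover : forall p : N, exists2 c, atlas N c & cdom c p.

(** Insert a chart [e] of [N] around [f p] and use the chain rule. By continuity [f] stays in the
    domain of [e] near [p], where inserting [e] changes nothing. *)
Lemma holomorphic_comp (f : M -> N) (g : N -> P) :
  holomorphic f -> holomorphic g -> holomorphic (g \o f).
Proof.
move=> [cf hf] [cg hg]; split.
  by move=> x; apply: continuous_comp; [exact: cf|exact: cg].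
move=> c d p Mc Pd cp dp; have [e Ne ep] := N_cover (f p).
have dc := hf _ _ _ Mc Ne cp ep.
have pE : (cmap e \o f \o chart_inv c p) (cmap c p) = cmap e (f p).
  by rewrite /= chart_invK //; exact: M_homeo.
have dg : differentiable (cmap d \o g \o chart_inv e (f p))
    ((cmap e \o f \o chart_inv c p) (cmap c p)).
  by rewrite pE; exact: hg.
apply: near_eq_differentiable (differentiable_comp dc dg).
have oe : nbhs (f p) (cdom e).
  by apply: open_nbhs_nbhs; split=> //; have [] := N_homeo Ne.
apply: filterS (chart_inv_nbhs (M_homeo Mc) cp (cf _ _ oe)) => v [ev cv vE].
by rewrite /= chart_invK //; exact: N_homeo.
Qed.

End holomorphic_comp.

(** * Quotients by group actions *)

Section quotient_space_theory.
Variables (G : groupType) (T : topologicalType) (mu : group_action G T).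
Local Notation proj := (quotient_proj mu).

Lemma act_invl g x : mu g^-1%g (mu g x) = x.
Proof. by rewrite -actM mulVg act1. Qed.

Lemma act_invr g x : mu g (mu g^-1%g x) = x.
Proof. by rewrite -actM mulgV act1. Qed.

Lemma proj_eq x y : proj x = proj y <-> exists g, mu g x = y.
Proof.
have e : x = y %[mod {eq_quot orbit_equiv mu}]%qT <-> exists g, mu g x = y.
  by split=> [/eqmodP/asboolP|h]; last by apply/eqmodP/asboolP.
exact: e.
Qed.

Lemma proj_act g x : proj (mu g x) = proj x.
Proof. by apply/esym/proj_eq; exists g. Qed.

Lemma proj_surj (p : quotient_space mu) : exists x, proj x = p.
Proof. by exists (repr p); rewrite /quotient_proj reprK. Qed.

Lemma proj_continuous : continuous proj.
Proof. exact: pi_continuous. Qed.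

Hypothesis mu_continuous : forall g, continuous (mu g).

(** The saturation of [U] is the union of its preimages under the elements of the group. *)
Lemma proj_open U : open U -> open (proj @` U).
Proof.
move=> oU; rewrite /open /= /quotient_open.
rewrite (_ : _ @^-1` _ = \bigcup_g (mu g @^-1` U)).
  apply: bigcup_open => g _.
  by apply: open_comp => // x _; exact: mu_continuous.
apply/seteqP; split=> x.
  move=> [y Uy /esym/proj_eq[g gx]]; exists g => //=.
  by rewrite gx.
by move=> [g _ /= Ugx]; exists (mu g x) => //; exact: proj_act.
Qed.

Lemma quotient_second_countable : @second_countable T ->
  @second_countable (quotient_space mu).
Proof.
move=> [B cB [oB bB]]; exists [set proj @` U | U in B].
  exact: sub_countable (card_image_le _ _) cB.
split; first by move=> _ [U BU <-]; apply: proj_open; exact: oB.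
move=> p A; have [x <-] := proj_surj p.
move=> /proj_continuous/bB[U [BU Ux] UA].
exists (proj @` U); first by split; [exists U|exists x].
by move=> _ [y Uy <-]; exact: UA.
Qed.

(** For [x] and [y] in different orbits this separates their images in the quotient; for [x = y] and
    a free action it yields an evenly covered neighbourhood. *)
Definition separated_action := forall x y : T, exists U V,
  [/\ open_nbhs x U, open_nbhs y V &
      forall g u v, U u -> V v -> mu g u = v -> mu g x = y].

(** Only finitely many [g] carry a point of [U] into [V]. For each of them with [mu g x <> y],
    disjoint neighbourhoods of [mu g x] and [y] are used to shrink [U] and [V]. *)
Lemma separated_action_finite : hausdorff_space T ->
  (forall x y : T, exists U V : set T, [/\ nbhs x U, nbhs y V &
    finite_set [set g | mu g @` U `&` V !=set0]]) -> separated_action.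
Proof.
move=> hT fin x y; have [U [V [xU yV /finite_fsetP[D DE]]]] := fin x y.
have /choice[AB ABP] g : exists AB : set T * set T,
    [/\ nbhs x AB.1, nbhs y AB.2 &
        forall u v, AB.1 u -> AB.2 v -> mu g u = v -> mu g x = y].
  have [gxy|] := pselect (mu g x = y).
    by exists (setT, setT); split=> //=; exact: filterT.
  have := @hT (mu g x) y; rewrite /cluster /= => /contra_not/[apply].
  move=> /existsNP[A /existsNP[B /not_implyP[gxA /not_implyP[yB AB0]]]].
  exists (mu g @^-1` A, B); split=> //=; first exact: mu_continuous.
  by move=> u v Au Bv guv; case: AB0; exists v; split=> //; rewrite -guv.
have xU' : nbhs x (U `&` \bigcap_(g in [set` D]) (AB g).1).
  by apply: filterI => //; apply: filter_bigI => g _; case: (ABP g).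
have yV' : nbhs y (V `&` \bigcap_(g in [set` D]) (AB g).2).
  by apply: filterI => //; apply: filter_bigI => g _; case: (ABP g).
move: xU' yV'; rewrite !nbhsE => -[U' oU' UU'] [V' oV' VV'].
exists U', V'; split=> // g u v /UU'[Uu ABu] /VV'[Vv ABv] guv.
have gD : [set` D] g by rewrite -DE; exists v; split=> //; exists u.
by have [_ _] := ABP g; apply; [exact: ABu|exact: ABv|exact: guv].
Qed.

Lemma quotient_hausdorff : separated_action ->
  hausdorff_space (quotient_space mu).
Proof.
move=> sep p q; have [x <-] := proj_surj p; have [y <-] := proj_surj q.
have [U [V [[oU Ux] [oV Vy] sUV]]] := sep x y.
move=> /(_ (proj @` U) (proj @` V)) [||r].
- by apply: open_nbhs_nbhs; split; [exact: proj_open|exists x].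
- by apply: open_nbhs_nbhs; split; [exact: proj_open|exists y].
- move=> [[u Uu <-] [v Vv /esym/proj_eq[g guv]]]; apply/proj_eq; exists g.
  exact: sUV guv.
Qed.

(** If [g] relates two points near [x], separation gives [mu g x = x], hence [g = 1]. *)
Lemma evenly_covered : separated_action -> free_action mu ->
  forall x, exists2 U, open_nbhs x U & set_inj U proj.
Proof.
move=> sep free x; have [U [V [[oU Ux] [oV Vx] sUV]]] := sep x x.
exists (U `&` V); first by split; [exact: openI|].
move=> u v /set_mem[Uu _] /set_mem[_ Vv] /proj_eq[g guv].
by have g1 := free _ _ (sUV _ _ _ Uu Vv guv); rewrite -guv g1 act1.
Qed.

End quotient_space_theory.

(** * The manifold structure of the quotient *)

Section quotient_manifold_theory.
Variables (R : realType) (n : nat) (G : groupType) (M : charted R n).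
Variable mu : group_action G M.
Local Notation proj := (quotient_proj mu).
Local Notation Y := (quotient_manifold mu).

Hypothesis M_manifold : complex_manifold M.
Hypothesis mu_holomorphic : forall g, holomorphic (mu g).

Let M_homeo : forall c, atlas M c -> homeo_chart c.
Proof. by case: M_manifold. Qed.

Let mu_continuous g : continuous (mu g).
Proof. by case: (mu_holomorphic g). Qed.

Lemma quotient_homeo c : atlas Y c -> homeo_chart c.
Proof.
case=> d [U [Md oU Ud injU [cU cE]]].
have [od injd contd imd] := M_homeo Md; split.
- by rewrite cU; exact: proj_open.
- move=> p q; rewrite cU => /set_mem[x Ux <-] /set_mem[y Uy <-].
  rewrite !cE // => e; congr (proj _).
  by apply: injd => //; apply: mem_set; exact: Ud.
- move=> p; rewrite cU => -[x Ux <-] A; rewrite cE // => Ax.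
  have := contd _ (Ud _ Ux) _ Ax; rewrite nbhs_simpl /= => UA.
  have : nbhs x (U `&` [set y | A (cmap d y)]).
    by apply: filterI => //; exact: open_nbhs_nbhs.
  rewrite nbhsE => -[W [oW Wx] WU].
  apply: (@filterS _ _ _ (proj @` W)).
    by move=> _ [y Wy <-] /=; have [Uy Ay] := WU _ Wy; rewrite cE.
  apply: (@open_nbhs_nbhs (quotient_space mu)); split; last by exists x.
  exact: proj_open.
- move=> W oW Wc.
  (* Openness is transported to the part of the sheet [U] above [W], where [d] is an open map. *)
  have -> : cmap c @` W = cmap d @` (U `&` proj @^-1` W).
    apply/seteqP; split.
      move=> _ [p Wp <-]; have := Wc _ Wp; rewrite cU => -[x Ux xp].
      by exists x; [split=> //=; rewrite xp|rewrite -xp cE].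
    by move=> _ [x [Ux Wx] <-]; exists (proj x) => //; rewrite cE.
  apply: imd; last by move=> x [Ux _]; exact: Ud.
  apply: openI => //; apply: open_comp => // x _; exact: proj_continuous.
Qed.

(* A map landing in the projection of U lifts to U after composition with an
   element of the group. *)
Lemma holomorphic_proj m (N : charted R m) (f : N -> M) :
    (forall c, atlas N c -> homeo_chart c) ->
  holomorphic f -> holomorphic (proj \o f : N -> Y).
Proof.
move=> N_homeo hf; split.
  by move=> x; apply: continuous_comp; [exact: hf.1|exact: proj_continuous].
move=> c d p Nc [d0 [U [Md oU Ud injU [dU dE]]]] cp; rewrite dU => -[x Ux].
move=> /esym/proj_eq[g gx].
have M_cover : forall p : M, exists2 c, atlas M c & cdom c p.
  by case: M_manifold.
have [cgf hgf] :=
  holomorphic_comp N_homeo M_homeo M_cover hf (mu_holomorphic g).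
have d0p : cdom d0 ((mu g \o f) p) by rewrite /= gx; exact: Ud.
apply: near_eq_differentiable (hgf _ _ _ Nc Md cp d0p).
have Ugx : nbhs ((mu g \o f) p) U.
  by apply: open_nbhs_nbhs; split=> //; rewrite /= gx.
have cc := N_homeo _ Nc.
apply: filterS (chart_inv_nbhs cc cp (cgf _ _ Ugx)) => v [/= Uv _ _].
by rewrite -dE // proj_act.
Qed.

Lemma quotient_complex_manifold : separated_action mu -> free_action mu ->
  complex_manifold Y.
Proof.
move=> sep free; case: M_manifold => -[_ sc conn] _ M_cover M_diff; split.
- split.
  + exact: quotient_hausdorff.
  + exact: quotient_second_countable.
  + have -> : [set: Y] = proj @` [set: M].
      by apply/seteqP; split=> // p _; have [x] := proj_surj p; exists x.
    apply: connected_continuous_connected => //.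
    by apply: continuous_subspaceT; exact: proj_continuous.
- exact: quotient_homeo.
- move=> p; have [x <-] := proj_surj p.
  have [U [oU Ux] injU] := evenly_covered sep free x.
  have [d Md dx] := M_cover x; have [od _ _ _] := M_homeo Md.
  pose W := U `&` cdom d.
  have injW : set_inj W proj.
    by move=> u v /set_mem[Uu _] /set_mem[Uv _]; apply: injU; exact: mem_set.
  exists (Chart (proj @` W)
    (fun q => cmap d (xget x [set y | W y /\ proj y = q]))); last by exists x.
  exists d, W; split=> //; [exact: openI|by move=> ? []|split=> //= y Wy].
  congr (cmap d _); case: xgetP => [_ -> [Wz zy]|/(_ y)[]//].
  by apply: injW => //; exact: mem_set.
- move=> c d p Yc Yd cp dp.
  have [c0 [U [Mc oU Uc injU [cU cE]]]] := Yc.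
  move: (cp); rewrite cU => -[x Ux xp].
  (* Near [cmap c p] the inverse of [c] is the projection after the inverse of [c0]. So the
     transition from [c] to [d] is the projection read in [c0] and [d], and the projection is
     holomorphic as its composite with the identity. *)
  have hid : holomorphic (@id M) 
    by split=> [?|? ? ? ? ? ? ?]; [exact: cvg_id|exact: M_diff].
  have c0x := Uc _ Ux.
  have := holomorphic_proj M_homeo hid.
  move=> -[_ /(_ c0 d x Mc Yd c0x)] /=; rewrite xp => /(_ dp).
  rewrite -xp cE //; apply: near_eq_differentiable.
  have Unx : nbhs x U by exact: open_nbhs_nbhs.
  apply: filterS (chart_inv_nbhs (M_homeo Mc) c0x Unx) => v [/= Uv _ vE].
  congr (cmap d _); rewrite -{2}vE -cE // chart_invK //.
    exact: quotient_homeo.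
  by rewrite cU; exists (chart_inv c0 x v).
Qed.

End quotient_manifold_theory.

(** * Topology of the complex numbers *)

(* Instance search does not find these through the structures put on R[i]. *)
#[local] Instance nbhs_complex_filter (R : realType) (z : R[i]) :
  ProperFilter (nbhs z) := @nbhs_pfilter R[i] z.

#[local] Instance nbhs_complex_mx_filter (R : realType) m n
    (M : 'M[R[i]]_(m, n)) :
  ProperFilter (nbhs M) := @nbhs_pfilter 'M[R[i]]_(m, n) M.

Section complex_plane.
Variable R : realType.
Implicit Types (z w : R[i]) (x e : R).

Lemma normc_real x : `|x%:C| = `|x|%:C :> R[i].
Proof. by rewrite normc_def /= expr0n addr0 sqrtr_sqr. Qed.

Lemma normc_i : `|'i : R[i]| = 1.
Proof. by rewrite normc_def /= expr0n expr1n add0r sqrtr1. Qed.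

Lemma norm_Im z : `|complex.Im z|%:C <= `|z|.
Proof.
by rewrite -normrN -ReiNIm (le_trans (normc_ge_Re _)) // normrM normc_i mulr1.
Qed.

Lemma norm_ReIm z : `|z| <= (`|complex.Re z| + `|complex.Im z|)%:C.
Proof.
rewrite {1}[z]complexE (le_trans (ler_normD _ _)) // normrM normc_i mul1r.
by rewrite !normc_real rmorphD.
Qed.

(** The order on [R[i]] only compares numbers with the same imaginary part. *)
Lemma gt0_complex z : 0 < z -> exists2 e, 0 < e & z = e%:C.
Proof.
by case: z => a b; rewrite ltcE /= => /andP[/eqP -> a0]; exists a.
Qed.

Lemma nbhs_dist (K : numFieldType) (V : normedModType K) (z : V) (e : K) :
  0 < e -> \forall w \near z, `|z - w| < e.
Proof.
by move=> e0; apply/nbhs_ballP; exists e => // w; rewrite -ball_normE.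
Qed.

Lemma Im_continuous : continuous (@complex.Im R).
Proof.
move=> z; apply/cvgrPdist_lt => e; rewrite -ltcR => e0.
apply: (filterS (F := nbhs z)) (nbhs_dist z e0) => w zw.
by rewrite -ltcR -raddfB; exact: le_lt_trans (norm_Im _) zw.
Qed.

Lemma real_complex_continuous : continuous (fun x : R => x%:C : R[i]).
Proof.
move=> x; apply/cvgrPdist_lt => _ /gt0_complex[e e0 ->].
apply: (filterS (F := nbhs x)) (nbhs_dist (x : R^o) e0) => y xy.
by rewrite -rmorphB normc_real ltcR.
Qed.

Lemma open_upper_half_plane : open [set z : R[i] | 0 < complex.Im z].
Proof.
by apply: (open_comp _ (@open_gt _ 0)) => z _; exact: Im_continuous.
Qed.

Lemma open_unit_disc : open [set z : R[i] | `|z| < 1].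
Proof.
rewrite openE => z /= z1; rewrite -subr_gt0 in z1.
apply: (filterS (F := nbhs z)) (nbhs_dist z z1) => w /= zw.
rewrite -(subrK z w) (le_lt_trans (ler_normD _ _)) // -ltrBrDr distrC.
exact: zw.
Qed.

Lemma open_neq0 (T : topologicalType) (f : T -> R[i]) :
  continuous f -> open [set x | f x != 0].
Proof. by move=> cf; rewrite openE => x /=; exact: cvgr_neq0 (cf x). Qed.

End complex_plane.

(** * Spaces whose topology is induced by finitely many complex coordinates *)

Section complex_coordinates.
Variables (R : realType) (T : topologicalType) (I : finType).
Variable phi : I -> T -> R[i].
Hypothesis phi_continuous : forall i, continuous (phi i).
Hypothesis phi_nbhs : forall x A, nbhs x A ->
  exists2 e : R, 0 < e & 
    forall y, (forall i, `|phi i y - phi i x| < e%:C) -> A y.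

Lemma cvg_coordinates (S : Type) (F : set_system S) (FF : Filter F)
    (f : S -> T) x :
  (forall i, phi i (f s) @[s --> F] --> phi i x) -> f s @[s --> F] --> x.
Proof.
move=> fx A /phi_nbhs[e e0 eA].
have e0' : 0 < e%:C by rewrite ltcR.
have : \forall s \near F, forall i, `|phi i x - phi i (f s)| < e%:C.
  by apply: filter_forall => i; exact: cvgr_dist_lt (fx i) _ e0'.
by apply: filterS => s h; apply: eA => i; rewrite distrC.
Qed.

Lemma coordinates_hausdorff :
  (forall x y, (forall i, phi i x = phi i y) -> x = y) -> hausdorff_space T.
Proof.
move=> sep x y xy; apply: sep => i.
apply: (@norm_hausdorff _ R[i]) => A B Ax By.
have [z [Az Bz]] := xy _ _ (phi_continuous Ax) (phi_continuous By).
by exists (phi i z).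
Qed.

Definition gauss_rat (q : rat * rat) : R[i] := ratr q.1 +i* ratr q.2.

Lemma gauss_rat_dense (z : R[i]) (e : R) : 0 < e ->
  exists q, `|z - gauss_rat q| < e%:C.
Proof.
move=> e0; have near_rat (x : R) : exists q, `|x - ratr q| < e / 2.
  have [|q] := @rat_in_itvoo R (x - e / 2) (x + e / 2); first by lra.
  by rewrite in_itv /= => ?; exists q; rewrite ltr_distlC; lra.
have [[a aE] [b bE]] := (near_rat (complex.Re z), near_rat (complex.Im z)).
exists (a, b); rewrite (le_lt_trans (norm_ReIm _)) // ltcR !raddfB /=.
by rewrite [e]splitr ltrD.
Qed.

(** The base consists of the preimages of the polydiscs with Gaussian rational centre and radius the
    inverse of a positive integer. *)
Lemma coordinates_second_countable : @second_countable T.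
Proof.
pose O (qk : {ffun I -> rat * rat} * nat) :=
  [set x | forall i, `|phi i x - gauss_rat (qk.1 i)| < (qk.2.+1%:R^-1 : R)%:C].
exists (range O); first exact: sub_countable (card_image_le _ _) (countableP _).
split.
  move=> _ [[q k] _ <-]; rewrite openE => x Ox; apply: filter_forall => i.
  have := Ox i; rewrite /= -subr_gt0 => /(nbhs_dist (phi i x)) Bx.
  apply: (@phi_continuous i x (fun z => `|z - gauss_rat (q i)| < _)).
  apply: (filterS (F := nbhs (phi i x))) Bx => z.
  rewrite ltrBrDr; apply: le_lt_trans.
  by rewrite (distrC (phi i x)); exact: ler_distD.
move=> x A /phi_nbhs[e e0 eA].
(* With radius below [e / 2], every point of a polydisc containing [x] is within [e] of [x] in each
   coordinate. *)
have [k _ ke] : exists2 k : nat, True & (k.+1%:R^-1 : R) < e / 2.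
  have e2 : 0 < e / 2 by rewrite divr_gt0.
  have [k /= _ ke] := near_infty_natSinv_lt (PosNum e2).
  by exists k => //; exact: (ke k (leqnn k)).
have k0 : 0 < (k.+1%:R^-1 : R) by rewrite invr_gt0.
have /choice[q qE] : forall i, exists q,
    `|phi i x - gauss_rat q| < (k.+1%:R^-1 : R)%:C.
  by move=> i; exact: gauss_rat_dense.
exists (O ([ffun i => q i], k)).
  by split; [exists ([ffun i => q i], k)|move=> i /=; rewrite ffunE].
move=> y Oy; apply: eA => i.
rewrite -(subrK (gauss_rat (q i)) (phi i y)) -addrA.
rewrite (le_lt_trans (ler_normD _ _)) // [e]splitr rmorphD ltrD //.
  by have := Oy i; rewrite /= ffunE => /lt_trans; apply; rewrite ltcR.
by rewrite distrC (lt_trans (qE i)) // ltcR.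
Qed.

End complex_coordinates.

(** * The manifold H x SL_2(C) *)

Section topology_extra.

Lemma set_val_continuous (T : topologicalType) (A : set T) :
  continuous (set_val : set_type A -> T).
Proof. exact: initial_continuous. Qed.

Lemma set_val_nbhs (T : topologicalType) (A : set T) (a : set_type A) U :
  nbhs a U -> exists2 W, nbhs (set_val a) W & set_val @^-1` W `<=` U.
Proof.
by move=> [_ [[W oW <-] Wa] WU]; exists W => //; exact: open_nbhs_nbhs.
Qed.

Lemma cvg_mx (T : topologicalType) m n (S : Type) (F : set_system S)
    (FF : Filter F) (f : S -> 'M[T]_(m, n)) (M : 'M[T]_(m, n)) :
  (forall i j, f s i j @[s --> F] --> M i j) -> f s @[s --> F] --> M.
Proof.
move=> fM A [P PM PA].
have : \forall s \near F, forall i j, P i j (f s i j).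
  by apply: filter_forall => i; apply: filter_forall => j; exact: fM.
by apply: filterS => s; exact: PA.
Qed.

End topology_extra.

(** * Global coordinates and charts of the product *)

Section HxSL2_coordinates.
Variable R : realType.
Local Notation C := R[i].
Local Notation X := (HxSL2 R).

Definition zpart (x : X) : C := set_val x.1.
Definition mpart (x : X) : 'M[C]_2 := set_val x.2.

Lemma zpart_gt0 x : 0 < complex.Im (zpart x).
Proof. by case: x => -[z zP] g; exact: set_mem zP. Qed.

Lemma det_mpart x : \det (mpart x) = 1.
Proof. by case: x => z [g gP]; exact: set_mem gP. Qed.

Lemma HxSL2_inj x y : zpart x = zpart y -> mpart x = mpart y -> x = y.
Proof.
case: x y => [z g] [w h] zw gh.
by congr pair; apply: val_inj.
Qed.

Fact i_gt0 : 'i \in [set z : C | 0 < complex.Im z].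
Proof. by apply: mem_set => /=. Qed.

Fact SL2_1 : 1%:M \in @SL2_set R.
Proof. by apply: mem_set; exact: det1. Qed.

(* A coordinate which is not admissible is replaced by that of (i, 1). *)
Definition mkX (z : C) (g : 'M[C]_2) : X :=
  (insubd (SigSub i_gt0 : set_type _) z, insubd (SigSub SL2_1 : set_type _) g).

Lemma zpart_mkX z g : 0 < complex.Im z -> zpart (mkX z g) = z.
Proof. by move=> z0; apply: insubdK; exact: mem_set. Qed.

Lemma mpart_mkX z g : \det g = 1 -> mpart (mkX z g) = g.
Proof. by move=> g1; apply: insubdK; exact: mem_set. Qed.

Lemma mkXK x : mkX (zpart x) (mpart x) = x.
Proof.
apply: HxSL2_inj; first by rewrite zpart_mkX //; exact: zpart_gt0.
by rewrite mpart_mkX //; exact: det_mpart.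
Qed.

(** The components of the embedding of the product into C^5, indexed by one finite type. *)
Definition coordX (i : option ('I_2 * 'I_2)) (x : X) : C :=
  if i is Some ij then mpart x ij.1 ij.2 else zpart x.

Lemma zpart_continuous : continuous zpart.
Proof.
move=> x; apply: (continuous_comp (f := fst)); first exact: cvg_fst.
exact: set_val_continuous.
Qed.

Lemma mpart_continuous : continuous mpart.
Proof.
move=> x; apply: (continuous_comp (f := snd)); first exact: cvg_snd.
exact: set_val_continuous.
Qed.

Lemma mpartij_continuous i j : continuous (fun x => mpart x i j).
Proof.
move=> x; apply: (@continuous_comp _ _ _ mpart (fun M : 'M[C]_2 => M i j)).
  exact: mpart_continuous.
exact: coord_continuous.
Qed.

Lemma coordX_continuous i : continuous (coordX i).
Proof.
by case: i => [[i j]|]; [exact: mpartij_continuous|exact: zpart_continuous].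
Qed.

Lemma coordX_nbhs x A : nbhs x A ->
  exists2 e : R, 0 < e & 
    forall y, (forall i, `|coordX i y - coordX i x| < e%:C) -> A y.
Proof.
case=> -[/= A1 A2] [/set_val_nbhs[W1 W1x W1A] /set_val_nbhs[W2 W2x W2A]] A12.
have /nbhs_ballP[_ /gt0_complex[e1 e10 ->] eW1] := W1x.
have /nbhs_ballP[_ /gt0_complex[e2 e20 ->] eW2] := W2x.
exists (Num.min e1 e2); first by rewrite lt_min e10.
move=> y ye; apply: A12; split; [apply: W1A|apply: W2A].
  apply: eW1; rewrite -ball_normE /= distrC.
  apply: lt_le_trans (ye None) _.
  by rewrite lecR ge_min lexx.
apply: eW2; split; first by rewrite ltcR.
move=> i j; rewrite -ball_normE /= distrC.
apply: lt_le_trans (ye (Some (i, j))) _.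
by rewrite lecR ge_min lexx orbT.
Qed.

Lemma coordX_inj x y : (forall i, coordX i x = coordX i y) -> x = y.
Proof.
move=> xy; apply: HxSL2_inj; first exact: (xy None).
by apply/matrixP => i j; exact: (xy (Some (i, j))).
Qed.

Lemma cvg_HxSL2 (S : Type) (F : set_system S) (FF : Filter F) (f : S -> X) x :
  zpart (f s) @[s --> F] --> zpart x ->
  (forall i j, mpart (f s) i j @[s --> F] --> mpart x i j) ->
  f s @[s --> F] --> x.
Proof.
move=> fz fm; apply: (cvg_coordinates coordX_nbhs) => -[[i j]|].
  exact: fm.
exact: fz.
Qed.

(** A positive imaginary part is an open condition, so it persists near the limit; determinant 1 is
    not, so it is assumed along the filter. *)
Lemma cvg_mkX (S : Type) (F : set_system S) (FF : Filter F) (z : S -> C)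
    (g : S -> 'M[C]_2) (z0 : C) (g0 : 'M[C]_2) :
  0 < complex.Im z0 -> (\forall s \near F, \det (g s) = 1) -> \det g0 = 1 ->
  z s @[s --> F] --> z0 -> (forall i j, g s i j @[s --> F] --> g0 i j) ->
  mkX (z s) (g s) @[s --> F] --> mkX z0 g0.
Proof.
move=> z00 det_g det_g0 zc gc; apply: cvg_HxSL2 => [|i j].
  rewrite (zpart_mkX _ z00).
  have near_z : \forall s \near F, 0 < complex.Im (z s).
    exact: (zc _ (open_nbhs_nbhs (conj (@open_upper_half_plane R) z00))).
  apply: cvg_trans zc; apply: near_eq_cvg.
  by apply: filterS near_z => s zs; rewrite (zpart_mkX _ zs).
rewrite (mpart_mkX _ det_g0); apply: cvg_trans (gc i j); apply: near_eq_cvg.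
by apply: filterS det_g => s gs; rewrite (mpart_mkX _ gs).
Qed.

Definition Xchart (i j : 'I_2) : chart R (1 + 3) X :=
  Chart [set x | mpart x i j != 0]
    (fun x => row_mx (const_mx (zpart x))
      (\row_(k < 3) [:: mpart x i j; mpart x i (rev_ord j);
                        mpart x (rev_ord i) j]`_k)).

Lemma atlas_HxSL2 c : atlas X c <-> exists i j, c = Xchart i j.
Proof.
have E i j : Chart (cdom (Chart setT (fun z : upper_half_plane R =>
      const_mx (set_val z) : 'rV_1)) `*` cdom (SL2_chart R i j))
    (fun p : X => row_mx (const_mx (set_val p.1))
       (cmap (SL2_chart R i j) p.2)) = Xchart i j.
  congr Chart; apply/seteqP; split=> x; first by case.
  by split.
split.
  move=> [c1 /= ->] [_ [[i j] _ <-] <-]; exists i, j; exact: E.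
move=> [i [j ->]]; exists (Chart setT (fun z : upper_half_plane R =>
      const_mx (set_val z) : 'rV_1)) => //.
by exists (SL2_chart R i j); [exists (i, j)|exact: E].
Qed.

End HxSL2_coordinates.

Arguments zpart {R} x.
Arguments mpart {R} x.

Section SL2_solve.
Variable K : fieldType.

(* The last entry is forced by the determinant; the sign is that of the
   permutation mapping i to j. *)
Definition SL2_solve (i j : 'I_2) (a b c : K) : 'M[K]_2 :=
  \matrix_(k, l) if k == i then if l == j then a else b
                 else if l == j then c else ((-1) ^+ (i + j) + b * c) / a.

Lemma det_SL2_solve i j a b c : a != 0 -> \det (SL2_solve i j a b c) = 1.
Proof.
move=> a0; rewrite [SL2_solve _ _ _ _ _]mx22E det_mx22 !mxE.
by case: i j => -[|[|//]] ? [[|[|//]] ?] /=;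
  rewrite ?expr0 ?expr1 ?sqrrN ?expr1n; field.
Qed.

Lemma SL2_solveE i j (g : 'M[K]_2) : \det g = 1 -> g i j != 0 ->
  g = SL2_solve i j (g i j) (g i (rev_ord j)) (g (rev_ord i) j).
Proof.
have o0 p : @Ordinal 2 0 p = 0 by apply: val_inj.
have o1 p : @Ordinal 2 1 p = 1 by apply: val_inj.
have r0 : rev_ord 0 = 1 :> 'I_2 by apply: val_inj.
have r1 : rev_ord 1 = 0 :> 'I_2 by apply: val_inj.
move=> + gij; rewrite {1 2}[g]mx22E det_mx22 => dg.
rewrite [RHS]mx22E !mxE; move: dg gij.
case: i j => -[|[|//]] p [[|[|//]] q]; rewrite ?o0 ?o1 ?r0 ?r1 /= => dg gij;
  congr mx22; rewrite ?expr0 ?expr1 ?sqrrN ?expr1n -?dg; by field.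
Qed.

End SL2_solve.

Section HxSL2_manifold.
Variable R : realType.
Local Notation C := R[i].
Local Notation X := (HxSL2 R).

Let o3 k : 'I_3 := inord k.

Definition zcoord (v : 'rV[C]_(1 + 3)) : C := v 0 (lshift 3 0).
Definition gcoord (v : 'rV[C]_(1 + 3)) (k : nat) : C := v 0 (rshift 1 (o3 k)).

Definition Xparam (i j : 'I_2) (v : 'rV[C]_(1 + 3)) : 'M[C]_2 :=
  SL2_solve i j (gcoord v 0) (gcoord v 1) (gcoord v 2).

Lemma zcoord_chart i j x : zcoord (cmap (Xchart R i j) x) = zpart x.
Proof. by rewrite /zcoord row_mxEl mxE. Qed.

Lemma gcoord_chart i j x k : (k < 3)%N -> gcoord (cmap (Xchart R i j) x) k =
  [:: mpart x i j; mpart x i (rev_ord j); mpart x (rev_ord i) j]`_k.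
Proof. by move=> k3; rewrite /gcoord row_mxEr mxE inordK. Qed.

Lemma XparamE i j x : cdom (Xchart R i j) x ->
  Xparam i j (cmap (Xchart R i j) x) = mpart x.
Proof.
by move=> x0; rewrite /Xparam !gcoord_chart // -SL2_solveE //; exact: det_mpart.
Qed.

Lemma rV4_eq (u v : 'rV[C]_(1 + 3)) : zcoord u = zcoord v ->
  (forall k, (k < 3)%N -> gcoord u k = gcoord v k) -> u = v.
Proof.
move=> zuv guv; apply/rowP => k; case: (splitP k) => l kl.
  have -> : k = lshift 3 0 by apply: val_inj; rewrite /= kl [l]ord1.
  exact: zuv.
have -> : k = rshift 1 (o3 l) by apply: val_inj; rewrite /= kl inordK.
exact: guv.
Qed.

Lemma zcoord_differentiable v : differentiable zcoord v.
Proof. exact: differentiable_coord. Qed.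

Lemma gcoord_differentiable k v : differentiable (gcoord^~ k) v.
Proof. exact: differentiable_coord. Qed.

(** Three entries are coordinates; the fourth is a rational function with denominator
    [gcoord v 0]. *)
Lemma Xparam_differentiable i j v k l : gcoord v 0 != 0 ->
  differentiable (fun v => Xparam i j v k l) v.
Proof.
move=> v0; have -> : (fun v => Xparam i j v k l) = (fun v =>
    if k == i then if l == j then gcoord v 0 else gcoord v 1
    else if l == j then gcoord v 2
    else ((-1) ^+ (i + j) + gcoord v 1 * gcoord v 2) * (gcoord v 0)^-1).
  by apply/funext => u; rewrite mxE.
case: (k == i); case: (l == j); try exact: gcoord_differentiable.
apply: (@differentiableM _ _
  (fun v => (-1) ^+ (i + j) + gcoord v 1 * gcoord v 2)
  (fun v => (gcoord v 0)^-1)).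
  apply: (@differentiableD _ _ _ (cst ((-1) ^+ (i + j) : C))
    (fun v => gcoord v 1 * gcoord v 2)); first exact: differentiable_cst.
  apply: (@differentiableM _ _ (gcoord^~ 1%N) (gcoord^~ 2%N));
    exact: gcoord_differentiable.
apply: (@differentiableV _ _ (gcoord^~ 0%N)) => //.
exact: gcoord_differentiable.
Qed.

Lemma Xchart_homeo i j : homeo_chart (Xchart R i j).
Proof.
(* The image of the chart. *)
pose V := [set v | 0 < complex.Im (zcoord v)] `&` [set v | gcoord v 0 != 0].
apply: (@homeo_chart_inv _ _ _ _ V (fun v => mkX (zcoord v) (Xparam i j v))).
- by apply: open_neq0; exact: mpartij_continuous.
- move=> x x0; apply: cvg_mx => a k; rewrite ord1 {a}.
  case: (splitP k) => l kl.
    have -> : k = lshift 3 l by apply: val_inj.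
    rewrite row_mxEl mxE; under eq_fun do rewrite row_mxEl mxE.
    exact: zpart_continuous.
  have -> : k = rshift 1 l by apply: val_inj.
  rewrite row_mxEr mxE; under eq_fun do rewrite row_mxEr mxE.
  by case: l {kl} => -[|[|[|//]]] ? /=; exact: mpartij_continuous.
- apply: openI.
    apply: (open_comp _ (@open_upper_half_plane R)) => v _.
    exact/differentiable_continuous/zcoord_differentiable.
  apply: open_neq0 => v.
  exact/differentiable_continuous/gcoord_differentiable.
- move=> v [v0 v1].
  have v1n : \forall u \near v, gcoord u 0 != 0.
    apply: (cvgr_neq0 (F := nbhs v)) v1.
    exact/differentiable_continuous/gcoord_differentiable.
  apply: (cvg_mkX (F := nbhs v)) => //.
  + by apply: filterS v1n => u; exact: det_SL2_solve.
  + exact: det_SL2_solve.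
  + exact/differentiable_continuous/zcoord_differentiable.
  + by move=> k l; exact/differentiable_continuous/Xparam_differentiable.
- move=> x x0; split.
    by split=> /=; rewrite ?zcoord_chart ?gcoord_chart //; exact: zpart_gt0.
  by rewrite XparamE // zcoord_chart mkXK.
- move=> v [v0 v1].
  have vm : mpart (mkX (zcoord v) (Xparam i j v)) = Xparam i j v.
    by rewrite mpart_mkX ?det_SL2_solve.
  have r k : (rev_ord k == k :> 'I_2) = false.
    by case: k => -[|[|//]] ?.
  split; first by rewrite /= vm mxE !eqxx.
  apply: rV4_eq; first by rewrite zcoord_chart zpart_mkX.
  move=> k k3; rewrite gcoord_chart // vm !mxE !eqxx !r.
  by case: k k3 => [|[|[|//]]].
Qed.

Lemma coord_chart_inv c x : atlas X c -> cdom c x ->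
  differentiable (zpart \o chart_inv c x) (cmap c x) /\
  forall k l, differentiable (fun v => mpart (chart_inv c x v) k l) (cmap c x).
Proof.
move=> /atlas_HxSL2[i [j ->]] cx.
have near_inv := chart_inv_near (Xchart_homeo i j) cx.
split.
  apply: near_eq_differentiable (zcoord_differentiable _).
  by apply: filterS near_inv => v [_ {1}<-]; rewrite zcoord_chart.
move=> k l; apply: near_eq_differentiable (@Xparam_differentiable i j _ k l _).
  by apply: filterS near_inv => v [cv {1}<-]; rewrite XparamE.
by rewrite gcoord_chart.
Qed.

(** Every component of a chart of [X] is one of the global coordinates, so holomorphy into [X] can
    be checked on these, without choosing a target chart. *)
Lemma holomorphic_HxSL2 m (N : charted R m) (f : N -> X) : continuous f ->
  (forall c p, atlas N c -> cdom c p ->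
    differentiable (zpart \o f \o chart_inv c p) (cmap c p) /\
    forall k l,
      differentiable (fun v => mpart (f (chart_inv c p v)) k l) (cmap c p)) ->
  holomorphic f.
Proof.
move=> cf df; split=> // c d p Nc /atlas_HxSL2[i [j ->]] cp fp.
have [dz dm] := df _ _ Nc cp.
apply: differentiable_mx => a k; rewrite ord1; case: (splitP k) => l kl.
  have -> : k = lshift 3 l by apply: val_inj.
  by under eq_fun do rewrite /= row_mxEl mxE.
have -> : k = rshift 1 l by apply: val_inj.
under eq_fun do rewrite /= row_mxEr mxE.
by case: l {kl} => -[|[|[|//]]] ? /=; exact: dm.
Qed.

End HxSL2_manifold.

Section HxSL2_complex_manifold.
Variable R : realType.
Local Notation C := R[i].
Local Notation X := (HxSL2 R).

Lemma HxSL2_homeo c : atlas X c -> homeo_chart c.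
Proof. by move=> /atlas_HxSL2[i [j ->]]; exact: Xchart_homeo. Qed.

Lemma HxSL2_cover (x : X) : exists2 c, atlas X c & cdom c x.
Proof.
have [i [j ij]] : exists i j, mpart x i j != 0.
  have [x00|] := eqVneq (mpart x 0 0) 0; last by exists 0, 0.
  have [x01|] := eqVneq (mpart x 0 1) 0; last by exists 0, 1.
  have := det_mpart x; rewrite [mpart x]mx22E det_mx22 x00 x01 !mul0r subr0.
  by move=> /esym/eqP; rewrite oner_eq0.
by exists (Xchart R i j) => //; apply/atlas_HxSL2; exists i, j.
Qed.

(** Each point is joined to a base point by a path: a straight segment in the convex half plane,
    paired with a polynomial curve in SL_2. *)
Lemma HxSL2_connected : connected [set: X].
Proof.
pose x := mkX ('i : C) 1%:M.
have path y : exists A : set X, [/\ connected A, A x & A y].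
  have [F [dF F0 F1]] := SL2_curve (det_mpart x) (det_mpart y).
  pose z (t : R) := (1 - t)%:C * zpart x + t%:C * zpart y.
  pose g (t : R) := map_mx (horner_eval t%:C) F.
  have det_g t : \det (g t) = 1 by rewrite det_map_mx dF rmorph1.
  have zE t : complex.Im (z t) =
      (1 - t) * complex.Im (zpart x) + t * complex.Im (zpart y).
    by rewrite /z; case: (zpart x) (zpart y) => [a b] [c d] /=; ring.
  have ge01 : 0 <= 1 :> R := ler01.
  exists ((fun t => mkX (z t) (g t)) @` `[0, 1]); split.
  - apply: connected_continuous_connected; first exact: segment_connected.
    apply: continuous_in_subspaceT => t.
    rewrite inE /= in_itv /= => /andP[t0 t1].
    have zt : 0 < complex.Im (z t).
      rewrite zE; have := zpart_gt0 x; have := zpart_gt0 y.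
      have [->|tn0] := eqVneq t 0; first by nra.
      have {tn0}t0 : 0 < t by rewrite lt_neqAle eq_sym tn0.
      by nra.
    apply: cvg_mkX => //; first by near=> s.
      have zc : continuous (fun t : R => (1 - t)%:C : C).
        move=> s; apply: continuous_comp; last exact: real_complex_continuous.
        by apply: cvgB; [exact: cvg_cst|exact: cvg_id].
      apply: cvgD; (apply: cvgM; last exact: cvg_cst).
        exact: zc.
      exact: real_complex_continuous.
    move=> i j; have -> : (fun s => g s i j) = (fun s : R => (F i j).[s%:C]).
      by apply/funext => s; rewrite mxE.
    rewrite mxE; apply: (@continuous_comp _ _ _ (fun s : R => s%:C : C)).
      exact: real_complex_continuous.
    exact/differentiable_continuous/differentiable_horner.
  - exists 0 => /=; first by rewrite in_itv /= lexx.
    have -> : z 0 = zpart x by rewrite /z subr0 mul0r addr0 mul1r.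
    have -> : g 0 = mpart x by rewrite -F0.
    by rewrite mkXK.
  - exists 1 => /=; first by rewrite in_itv /= lexx ler01.
    have -> : z 1 = zpart y by rewrite /z subrr mul0r add0r mul1r.
    have -> : g 1 = mpart y by rewrite -F1.
    by rewrite mkXK.
have /choice[A Ap] := path.
have -> : [set: X] = \bigcup_(y in setT) A y.
  by apply/seteqP; split=> // y _; exists y => //; case: (Ap y).
apply: bigcup_connected; last by move=> y _; case: (Ap y).
by exists x => y _; case: (Ap y).
Unshelve. all: by end_near. Qed.

(** Read in charts, this is the differentiability of the transition maps. *)
Lemma holomorphic_id : holomorphic (@id X).
Proof.
apply: holomorphic_HxSL2 => [x|c p Nc cp]; first exact: cvg_id.
exact: coord_chart_inv.
Qed.

Lemma HxSL2_complex_manifold : complex_manifold X.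
Proof.
split.
- split; last exact: HxSL2_connected.
  + exact: coordinates_hausdorff (@coordX_continuous R) (@coordX_inj R).
  + exact: coordinates_second_countable (@coordX_continuous R) (@coordX_nbhs R).
- exact: HxSL2_homeo.
- exact: HxSL2_cover.
- by move=> c d p Xc Xd cp dp; exact: holomorphic_id.2.
Qed.

Lemma holomorphic_affine (f : X -> X) (a b : C) (S : 'M[C]_2) :
  (forall x, zpart (f x) = a * zpart x + b) ->
  (forall x, mpart (f x) = S *m mpart x) -> holomorphic f.
Proof.
move=> fz fm.
have fm2 x k l : mpart (f x) k l =
    S k 0 * mpart x 0 l + S k 1 * mpart x 1 l.
  rewrite fm mxE !big_ord_recl big_ord0 addr0.
  by congr (_ + S _ _ * mpart x _ l); apply: val_inj.
apply: holomorphic_HxSL2.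
  move=> x; apply: cvg_HxSL2 => [|k l].
    under eq_fun do rewrite fz; rewrite fz.
    apply: cvgD; last exact: cvg_cst.
    by apply: cvgM; [exact: cvg_cst|exact: zpart_continuous].
  under eq_fun do rewrite fm2; rewrite fm2.
  by apply: cvgD; (apply: cvgM; [exact: cvg_cst|exact: mpartij_continuous]).
move=> c p Xc cp; have [dz dm] := coord_chart_inv Xc cp; split.
  have -> : zpart \o f \o chart_inv c p =
      cst a * (zpart \o chart_inv c p) + cst b.
    by apply/funext => v /=; rewrite fz.
  apply: differentiableD; last exact: differentiable_cst.
  by apply: differentiableM => //; exact: differentiable_cst.
move=> k l.
have -> : (fun v => mpart (f (chart_inv c p v)) k l) =
    cst (S k 0) * (fun v => mpart (chart_inv c p v) 0 l) +
    cst (S k 1) * (fun v => mpart (chart_inv c p v) 1 l).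
  by apply/funext => v /=; rewrite fm2.
apply: differentiableD; apply: differentiableM => //; exact: differentiable_cst.
Qed.

End HxSL2_complex_manifold.

(** * The unit disc and holomorphic discs in the product *)

Section unit_disc_theory.
Variable R : realType.
Local Notation C := R[i].

Fact disc_0 : 0 \in [set z : C | `|z| < 1].
Proof. by apply: mem_set; rewrite /= normr0 ltr01. Qed.

Definition disc_of (z : C) : unit_disc R :=
  insubd (SigSub disc_0 : set_type _) z.

Lemma disc_ofK z : `|z| < 1 -> set_val (disc_of z) = z.
Proof. by move=> z1; apply: insubdK; exact: mem_set. Qed.

Lemma disc_lt1 (z : unit_disc R) : `|set_val z : C| < 1.
Proof. by case: z => z zP; exact: set_mem zP. Qed.

Lemma unit_disc_homeo c : atlas (unit_disc R) c -> homeo_chart c.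
Proof.
move=> ->.
have v00 (v : 'rV[C]_1) : {for v, continuous (fun v : 'rV[C]_1 => v 0 0)}.
  exact: coord_continuous.
apply: (@homeo_chart_inv _ _ _ _ [set v | `|v 0 0| < 1]
  (fun v => disc_of (v 0 0))).
- exact: openT.
- move=> z _; apply: (cvg_mx (@nbhs_filter (unit_disc R) z)) => i j.
  rewrite mxE; under eq_fun do rewrite mxE.
  exact: set_val_continuous.
- by apply: (open_comp _ (@open_unit_disc R)) => v _; exact: v00.
- move=> v v1 A /set_val_nbhs[W]; rewrite disc_ofK // => Wv WA.
  have := @v00 v _ (open_nbhs_nbhs (conj (@open_unit_disc R) v1)).
  apply: (filterS2 (F := nbhs v)) (@v00 v _ Wv) => u Wu u1; apply: WA.
  by rewrite /= disc_ofK.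
- move=> z _ /=; rewrite mxE; split; first exact: disc_lt1.
  by apply: val_inj; apply: disc_ofK; exact: disc_lt1.
- by move=> v v1; split=> //=; apply/rowP => i; rewrite mxE disc_ofK // ord1.
Qed.

Lemma disc_holomorphic (h : C -> C) (G : C -> 'M[C]_2) :
  (forall z, `|z| < 1 -> 0 < complex.Im (h z)) -> (forall z, \det (G z) = 1) ->
  (forall z, differentiable h z) ->
  (forall k l z, differentiable (fun z => G z k l) z) ->
  holomorphic (fun z : unit_disc R => mkX (h (set_val z)) (G (set_val z))).
Proof.
move=> h0 G1 dh dG; apply: holomorphic_HxSL2.
  move=> z; apply: (cvg_mkX (@nbhs_filter (unit_disc R) z)) => //.
  - exact/h0/disc_lt1.
  - by near=> s.
  - apply: (@continuous_comp _ _ _ (set_val : unit_disc R -> C)).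
      exact: set_val_continuous.
    exact: differentiable_continuous.
  - move=> k l; apply: (@continuous_comp _ _ _ (set_val : unit_disc R -> C)
      (fun z => G z k l)).
      exact: set_val_continuous.
    exact: differentiable_continuous.
move=> c p Dc cp.
have near_inv := chart_inv_near (unit_disc_homeo Dc) cp.
move: Dc near_inv => -> near_inv.
have d00 (v : 'rV[C]_1) : differentiable (fun v : 'rV[C]_1 => v 0 0) v.
  exact: differentiable_coord.
split.
  apply: near_eq_differentiable (differentiable_comp (d00 _) (dh _)).
  apply: filterS near_inv => v [_ /= {1}<-].
  by rewrite mxE zpart_mkX //; exact/h0/disc_lt1.
move=> k l.
apply: near_eq_differentiable (differentiable_comp (d00 _) (dG k l _)).
by apply: filterS near_inv => v [_ /= {1}<-]; rewrite mxE mpart_mkX.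
Unshelve. all: by end_near. Qed.

End unit_disc_theory.

(** * The action of the free group *)

Section sanov_finite.

Lemma finite_bounded_int_mx m n (B : nat) :
  finite_set [set M : 'M[int]_(m, n) | forall i j, `|M i j| <= B%:Z].
Proof.
(* The integers from [-B] to [B] are the ordinals below [2 B + 1] shifted by [B]. *)
pose f (N : 'M['I_(B + B).+1]_(m, n)) : 'M[int]_(m, n) :=
  map_mx (fun k : 'I_(B + B).+1 => (k : nat)%:Z - B%:Z) N.
apply: (@sub_finite_set _ _ (f @` setT)); last first.
  by apply: finite_image; exact: finite_finset.
move=> M MB; exists (map_mx (fun k : int => inord (absz (k + B%:Z))) M) => //.
apply/matrixP => i j; have := MB i j; rewrite !mxE; move: (M i j) => k kB.
by rewrite inordK; lia.
Qed.

(** The embedding is injective with values in integer matrices; this expresses the discreteness of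
    its image. *)
Lemma finite_bounded_sanov (B : nat) :
  finite_set [set w | forall i j, `|sanov w i j| <= B%:Z].
Proof.
apply: (finite_preimage (f := sanov)) (finite_bounded_int_mx 2 2 B).
by move=> u v _ _; exact: sanov_inj.
Qed.

End sanov_finite.

Section action.
Variable R : realType.
Local Notation C := R[i].
Local Notation X := (HxSL2 R).

(* 1 and sqrt 2 generate a dense subgroup of the reals, and the translation by 1
   makes the commutator of the generators a nonzero translation. *)
Definition exponent (l : bool * bool) : R :=
  (-1) ^+ (~~ l.2) * (if l.1 then 1 else Num.sqrt 2).

(** One generator acts by z |-> e z, the other by z |-> e^(sqrt 2) z + 1; the last value is the
    constant term of the inverse of the latter. *)
Definition translation (l : bool * bool) : R :=
  if l.1 then 0 else if l.2 then 1 else - expR (exponent l).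

Definition int_mx (S : 'M[int]_2) : 'M[C]_2 := map_mx intr S.

Lemma det_int_mx S : \det S = 1 -> \det (int_mx S) = 1.
Proof. by rewrite det_map_mx => ->; rewrite rmorph1. Qed.

Definition affine_map (u t : R) (S : 'M[int]_2) (x : X) : X :=
  mkX ((expR u)%:C * zpart x + t%:C) (int_mx S *m mpart x).

Lemma zpart_affine u t S x :
  zpart (affine_map u t S x) = (expR u)%:C * zpart x + t%:C.
Proof.
rewrite zpart_mkX //; have := zpart_gt0 x; case: (zpart x) => a b /= b0.
by rewrite mul0r !addr0 mulr_gt0 ?expR_gt0.
Qed.

Lemma mpart_affine u t S x : \det S = 1 ->
  mpart (affine_map u t S x) = int_mx S *m mpart x.
Proof.
by move=> S1; rewrite mpart_mkX // det_mulmx det_mpart det_int_mx // mulr1.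
Qed.

Definition letter_map (l : bool * bool) : X -> X :=
  affine_map (exponent l) (translation l) (sanov_letter l).

Lemma letter_mapK l x : letter_map l (letter_map (letter_inv l) x) = x.
Proof.
apply: HxSL2_inj.
  have el : exponent (letter_inv l) = - exponent l.
    by case: l => -[] []; rewrite /exponent /= expr0 expr1; ring.
  have tl : translation l + expR (exponent l) * translation (letter_inv l) = 0.
    case: l el => -[] [] el; rewrite /translation /= ?mulr0 ?addr0 //.
      by rewrite el mulrN -expRD subrr expR0 subrr.
    by rewrite mulr1 addNr.
  rewrite !zpart_affine el mulrDr mulrA -!rmorphM -expRD subrr expR0 mul1r.
  by rewrite -addrA -rmorphD addrC (addrC _ (translation l)) tl add0r.
rewrite !mpart_affine ?det_sanov_letter // mulmxA -map_mxM sanov_letterK.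
by rewrite map_mx1 mul1mx.
Qed.

Definition F2_action : group_action F2 X := free_group_action letter_mapK.
Local Notation mu := F2_action.

Lemma mpart_F2_action w x : mpart (mu w x) = int_mx (sanov w) *m mpart x.
Proof.
rewrite /F2_action /= /word_act /sanov; elim: (val w) => [|l u IH] /=.
  by rewrite /int_mx map_mx1 mul1mx.
by rewrite mpart_affine ?det_sanov_letter // IH mulmxA -map_mxM.
Qed.

(** The dilation is recorded by its logarithm [u], so that exponents add under products. *)
Definition acts_affinely (w : F2) (u t : R) :=
  forall x, zpart (mu w x) = (expR u)%:C * zpart x + t%:C.

Lemma acts_affinelyM g h u t v s : acts_affinely g u t -> acts_affinely h v s ->
  acts_affinely (g * h)%g (u + v) (expR u * s + t).
Proof.
by move=> gE hE x; rewrite actM gE hE expRD !rmorphD !rmorphM; ring.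
Qed.

Lemma acts_affinelyV g u t : acts_affinely g u t ->
  acts_affinely g^-1%g (- u) (- (expR (- u) * t)).
Proof.
move=> gE x; have := gE (mu g^-1%g x); rewrite act_invr => ->.
rewrite mulrDr mulrA -!rmorphM -expRD addNr expR0 mul1r rmorphN.
by rewrite addrK.
Qed.

Lemma acts_affinelyP w : exists u t, acts_affinely w u t.
Proof.
rewrite /acts_affinely /F2_action /= /word_act.
elim: (val w) => [|l s [u [t IH]]] /=.
  by exists 0, 0 => x; rewrite expR0 mul1r addr0.
exists (exponent l + u), (expR (exponent l) * t + translation l) => x.
by rewrite zpart_affine IH expRD !rmorphD !rmorphM; ring.
Qed.

Lemma F2_action_holomorphic w : holomorphic (mu w).
Proof.
have [u [t wE]] := acts_affinelyP w.
exact: holomorphic_affine wE (mpart_F2_action w).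
Qed.

Lemma F2_action_biholomorphic w : biholomorphic (mu w).
Proof.
split; first exact: F2_action_holomorphic.
exists (mu w^-1%g); split; first exact: F2_action_holomorphic.
- exact: act_invl.
- exact: act_invr.
Qed.

Lemma F2_action_continuous w : continuous (mu w).
Proof. by case: (F2_action_holomorphic w). Qed.

(** A fixed point gives [sanov w] times an invertible matrix equal to that matrix, so [sanov w] is
    the identity. *)
Lemma F2_action_free : free_action mu.
Proof.
move=> w x wx; apply: sanov_eq1; apply/matrixP => i j.
have xU : mpart x \in unitmx by rewrite unitmxE det_mpart unitr1.
have : int_mx (sanov w) = 1%:M.
  by rewrite -(mulmxK xU (int_mx _)) -mpart_F2_action wx mulmxV.
move=> /matrixP/(_ i j); rewrite !mxE => /eqP.
by rewrite -mulrz_nat eqr_int => /eqP.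
Qed.

Definition mbounded (B : nat) (x : X) := forall i j, `|mpart x i j| <= B%:R.

(** The matrix of [w] is [mpart (mu w x)] times the inverse of [mpart x]. That inverse is the
    adjugate, with the same entries up to sign and order, so the entries of [sanov w] are at most
    [2 B^2] in absolute value. *)
Lemma finite_mbounded (B : nat) :
  finite_set [set w | exists2 x, mbounded B x & mbounded B (mu w x)].
Proof.
apply: sub_finite_set (finite_bounded_sanov (B * B + B * B)) => w.
move=> [x xB wxB] i j.
have wE : int_mx (sanov w) = mpart (mu w x) *m
    mx22 (mpart x 1 1) (- mpart x 0 1) (- mpart x 1 0) (mpart x 0 0).
  have := det_mpart x; rewrite mpart_F2_action -mulmxA {2}[mpart x]mx22E.
  rewrite {1}[mpart x]mx22E det_mx22 mul_mx22 => dx.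
  rewrite -[LHS]mulmx1 mx22_1; congr (_ *m mx22 _ _ _ _); rewrite -?dx; ring.
rewrite -(ler_int C) intr_norm.
have -> : (sanov w i j)%:~R = int_mx (sanov w) i j by rewrite mxE.
rewrite wE mxE !big_ord_recl big_ord0 addr0 (le_trans (ler_normD _ _)) //.
rewrite PoszD intrD !PoszM !intrM lerD // normrM ler_pM //; try exact: wxB.
  by rewrite mxE; case: ifP => _; rewrite ?normrN; exact: xB.
by rewrite mxE; case: ifP => _; rewrite ?normrN; exact: xB.
Qed.

Lemma near_mbounded (x : X) : exists B : nat, nbhs x (mbounded B).
Proof.
have /choice[b bP] (k : 'I_2 * 'I_2) : exists n : nat,
    `|mpart x k.1 k.2| < n%:R.
  have /gt0_complex[e e0 eE] : 0 < `|mpart x k.1 k.2| + 1 by rewrite ltr_wpDl.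
  exists (Num.bound e); apply: lt_trans (_ : e%:C < _).
    by rewrite -eE ltrDl.
  rewrite -(rmorph_nat (real_complex R)) ltcR.
  exact: archi_boundP (ltW e0).
exists (\max_k b k).
have : \forall y \near x, forall k, `|mpart y k.1 k.2| < (b k)%:R.
  apply: (@filter_forall X _ (fun k y => _ < _) (nbhs x) _) => k.
  have := bP k; rewrite -subr_gt0 => /(nbhs_dist (mpart x k.1 k.2)) near_k.
  have near_x := @mpartij_continuous R k.1 k.2 x _ near_k.
  apply: (@filterS X (nbhs x) _ _ _ _ near_x) => y yk.
  rewrite -(subrK (mpart x k.1 k.2) (mpart y _ _)).
  by rewrite (le_lt_trans (ler_normD _ _)) // -ltrBrDr distrC; exact: yk.
apply: (@filterS X (nbhs x)) => y yb i j; apply: le_trans (ltW (yb (i, j))) _.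
by rewrite ler_nat; exact: (leq_bigmax (i, j)).
Qed.

Lemma mbounded_le (A B : nat) x : (A <= B)%N -> mbounded A x -> mbounded B x.
Proof. by move=> AB xA i j; rewrite (le_trans (xA i j)) // ler_nat. Qed.

Lemma F2_action_separated : separated_action mu.
Proof.
apply: separated_action_finite; first exact: F2_action_continuous.
  by have [[]] := HxSL2_complex_manifold R.
move=> x y; have [[A xA] [B yB]] := (near_mbounded x, near_mbounded y).
exists (mbounded A), (mbounded B); split=> //.
apply: sub_finite_set (finite_mbounded (maxn A B)) => w [_ [[u uA <-] wB]].
by exists u; [apply: mbounded_le uA; rewrite leq_maxl|
  apply: mbounded_le wB; rewrite leq_maxr].
Qed.

(** The sets [mbounded B] increase with [B], and each point has one of them as a neighbourhood; a
    compact set therefore lies in a single one. *)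
Lemma F2_action_properly_discontinuous : properly_discontinuous mu.
Proof.
move=> K /compact_near_coveringP cK.
have [] := cK nat \oo mbounded _.
  move=> x _; have [B xB] := near_mbounded x.
  exists (mbounded B, [set A | (B <= A)%N]); first by split=> //; exists B.
  by move=> [y A] [/= yB BA]; exact: mbounded_le BA yB.
move=> B _ /(_ B (leqnn B)) KB.
apply: sub_finite_set (finite_mbounded B) => w [_ [[x Kx <-] Kwx]].
by exists x; exact: KB.
Qed.

(** * Density of the orbits in the half plane *)

Definition generator (l : bool * bool) : F2 :=
  exist _ [:: l] isT.

Lemma acts_affinely_generator l :
  acts_affinely (generator l) (exponent l) (translation l).
Proof. by move=> x; exact: zpart_affine. Qed.

Lemma acts_affinelyB g h u t v s : acts_affinely g u t -> acts_affinely h v s ->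
  acts_affinely (g * h^-1)%g (u - v) (t - expR (u - v) * s).
Proof.
move=> gE hE; have := acts_affinelyM gE (acts_affinelyV hE).
by congr acts_affinely; rewrite expRD; ring.
Qed.

Let exponents := [set u | exists w t, acts_affinely w u t].
Let translations := [set t | exists w, acts_affinely w 0 t].

Lemma exponentsB u v : exponents u -> exponents v -> exponents (u - v).
Proof.
move=> [g [t gE]] [h [s hE]]; exists (g * h^-1)%g; eexists.
exact: acts_affinelyB gE hE.
Qed.

Lemma translationsB s t :
  translations s -> translations t -> translations (s - t).
Proof.
move=> [g gE] [h hE]; exists (g * h^-1)%g.
by have := acts_affinelyB gE hE; rewrite subrr expR0 mul1r.
Qed.

(* (sqrt 2 - 1) ^+ n.+2 = (sqrt 2 - 1) ^+ n - 2 (sqrt 2 - 1) ^+ n.+1 *)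
Lemma exponents_small e : 0 < e -> exists2 u, exponents u & 0 < u < e.
Proof.
move=> e0; pose r : R := Num.sqrt 2.
have r2 : r ^+ 2 = 2 by rewrite sqr_sqrtr.
have r0 : 0 <= r by exact: sqrtr_ge0.
have G1 : exponents 1.
  have := acts_affinely_generator (true, true); rewrite /exponent mul1r.
  by exists (generator (true, true)), 0.
have Gr : exponents r.
  have := acts_affinely_generator (false, true); rewrite /exponent mul1r.
  by exists (generator (false, true)), 1.
have Gn n : exponents ((r - 1) ^+ n) /\ exponents ((r - 1) ^+ n.+1).
  elim: n => [|n [G0 G1']].
    by rewrite expr0 expr1; split=> //; exact: exponentsB.
  split=> //.
  have -> : (r - 1) ^+ n.+2 = (r - 1) ^+ n - (r - 1) ^+ n.+1 - (r - 1) ^+ n.+1.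
    rewrite !exprS; set q := _ ^+ n.
    have -> : (r - 1) * ((r - 1) * q) = (r ^+ 2 - 2 * r + 1) * q by ring.
    by rewrite r2; ring.
  by do 2! apply: exponentsB => //.
have [n _ ne] := near_infty_natSinv_expn_lt (PosNum e0).
exists ((r - 1) ^+ n); first by case: (Gn n).
have r1 : 1 < r by nra.
(* The powers of [r - 1] are thus dominated by those of 1/2. *)
have rh : r - 1 <= 2^-1 by rewrite -div1r; nra.
rewrite exprn_gt0 ?subr_gt0 //=; apply: le_lt_trans (ne n (leqnn n)).
by rewrite /= div1r -exprVn lerXn2r // nnegrE ?invr_ge0 // subr_ge0 ltW.
Qed.

(** With [a] the dilation by e, the element [a * b * (b * a)^-1] is the translation by e - 1, and
    conjugating by powers of [a] divides it by powers of e. *)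
Lemma translations_small e : 0 < e -> exists2 t, translations t & 0 < t < e.
Proof.
move=> e0; pose a := generator (true, true); pose b := generator (false, true).
have aE : acts_affinely a 1 0.
  by have := acts_affinely_generator (true, true); rewrite /exponent mul1r.
have bE : acts_affinely b (Num.sqrt 2) 1.
  by have := acts_affinely_generator (false, true); rewrite /exponent mul1r.
pose E : R := expR 1.
have E1 : 1 < E by rewrite /E expR_gt1.
have T0 : translations (E - 1).
  exists ((a * b) * (b * a)^-1)%g.
  have := acts_affinelyB (acts_affinelyM aE bE) (acts_affinelyM bE aE).
  by rewrite (addrC 1) subrr expR0 mulr0 add0r addr0 mulr1 mul1r.
have TE t n : translations t -> translations (t / E ^+ n).
  move=> Tt; elim: n => [|n [w wE]]; first by rewrite expr0 divr1.
  exists (a^-1 * w * a)%g.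
  have := acts_affinelyM (acts_affinelyM (acts_affinelyV aE) wE) aE.
  congr acts_affinely; first by ring.
  by rewrite mulr0 add0r mulr0 oppr0 addr0 expRN exprS invfM mulrCA.
have E1' : 0 < E - 1 by rewrite subr_gt0.
have [n _ ne] := near_infty_natSinv_expn_lt (PosNum (divr_gt0 e0 E1')).
exists ((E - 1) / E ^+ n); first exact: TE.
have E0 : 0 < E by exact: expR_gt0.
rewrite divr_gt0 ?exprn_gt0 //= mulrC -ltr_pdivlMr //.
apply: le_lt_trans (ne n (leqnn n)).
rewrite /= div1r lef_pV2 ?posrE ?exprn_gt0 // lerXn2r ?nnegrE ?(ltW E0) //.
(* The bound [2 <= E] compares the powers of [E] with those of 2. *)
by apply: le_trans (expR_ge1Dx 1); lra.
Qed.

(** First an element [g] adjusts the imaginary part through its dilation; then a pure translation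
    [h] corrects the real part without changing the imaginary one. Each costs at most [e / 2]. *)
Lemma orbit_dense (x y : X) (e : R) : 0 < e ->
  exists w, `|zpart (mu w y) - zpart x| <= e%:C.
Proof.
move=> e0; set b := complex.Im (zpart x); set d := complex.Im (zpart y).
have b0 : 0 < b := zpart_gt0 x; have d0 : 0 < d := zpart_gt0 y.
have bd : expR (ln (b / d)) = b / d by rewrite lnK // posrE divr_gt0.
(* If [u] is below [ln (b / d)] by [v], the imaginary part is off by [b * (1 - expR (- v))], at most
   [b * v]; hence the tolerance [e / (2 * b)]. *)
have eta0 : 0 < e / (2 * b) by rewrite divr_gt0 ?mulr_gt0.
have [u [g [t gE]] /andP[uY Yu]] :=
  subgroup_dense exponentsB exponents_small (ln (b / d)) eta0.
have e2 : 0 < e / 2 by rewrite divr_gt0.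
have [s [h hE] /andP[sY Ys]] := subgroup_dense translationsB translations_small
  (complex.Re (zpart x) - (expR u * complex.Re (zpart y) + t)) e2.
exists (h * g)%g; rewrite (acts_affinelyM hE gE) add0r expR0 mul1r.
rewrite (le_trans (norm_ReIm _)) // lecR.
have -> : complex.Re ((expR u)%:C * zpart y + (t + s)%:C - zpart x) =
    expR u * complex.Re (zpart y) + (t + s) - complex.Re (zpart x).
  by case: (zpart x) (zpart y) => [? ?] [? ?] /=; ring.
have -> : complex.Im ((expR u)%:C * zpart y + (t + s)%:C - zpart x) =
    expR u * d - b.
  by rewrite /d /b; case: (zpart x) (zpart y) => [? ?] [? ?] /=; ring.
rewrite [e]splitr lerD //; first by rewrite ler_norml; lra.
have uE : expR u = expR (ln (b / d)) * expR (u - ln (b / d)).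
  by rewrite -expRD addrC subrK.
have -> : expR u * d - b = - (b * (1 - expR (u - ln (b / d)))).
  by rewrite uE bd; field; rewrite gt_eqF.
rewrite normrN normrM gtr0_norm // -ler_pdivlMl //.
have le1 : expR (u - ln (b / d)) <= 1 by rewrite -expR0 ler_expR subr_le0.
rewrite ger0_norm ?subr_ge0 //.
have := expR_ge1Dx (u - ln (b / d)).
have -> : b^-1 * (e / 2) = e / (2 * b) by field; rewrite gt_eqF.
lra.
Qed.

(** * Discs and the Kobayashi pseudodistance *)

Lemma disc_through (x y : X) (s : R) : 0 < s < 1 ->
  `|zpart y - zpart x| <= (s * complex.Im (zpart x))%:C ->
  exists f : unit_disc R -> X,
    [/\ holomorphic f, f (disc_of 0) = x & f (disc_of s%:C) = y].
Proof.
move=> /andP[s0 s1] xy.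
have [F [dF F0 F1]] := SL2_curve (det_mpart x) (det_mpart y).
have sC0 : s%:C != 0 :> C by rewrite (inj_eq (@complexI R)) gt_eqF.
pose h (z : C) : C := zpart x + (zpart y - zpart x) / s%:C * z.
pose G (z : C) : 'M[C]_2 := map_mx (horner_eval ((s%:C)^-1 * z)) F.
exists (fun z => mkX (h (set_val z)) (G (set_val z))); split.
- apply: disc_holomorphic.
  + move=> z z1; set u := (zpart y - zpart x) / s%:C * z.
    (* The slope of [h] has modulus at most [Im (zpart x)] and [z] is in the unit disc, so [h z]
       stays in the half plane. *)
    have : `|u| < (complex.Im (zpart x))%:C.
      have yxs : `|(zpart y - zpart x) / s%:C| <= (complex.Im (zpart x))%:C.
        rewrite normrM normfV normc_real (gtr0_norm s0).
        by rewrite ler_pdivrMr ?ltcR //; move: xy; rewrite rmorphM mulrC.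
      rewrite normrM; apply: le_lt_trans (ler_wpM2r _ yxs) _ => //.
      by rewrite gtr_pMr // ltcR; exact: zpart_gt0.
    move=> /(le_lt_trans (norm_Im _)); rewrite ltcR ltr_norml => /andP[+ _].
    have -> : complex.Im (h z) = complex.Im (zpart x) + complex.Im u.
      by rewrite /h -/u raddfD.
    lra.
  + by move=> z; rewrite det_map_mx dF rmorph1.
  + move=> z; apply: (@differentiableD _ _ _ (cst (zpart x))
      (cst ((zpart y - zpart x) / s%:C) * id)); first exact: differentiable_cst.
    by apply: differentiableM => //; exact: differentiable_cst.
  + move=> k l z.
    have -> : (fun z => G z k l) = horner (F k l) \o (cst ((s%:C)^-1) * id).
      by apply/funext => w; rewrite mxE.
    apply: differentiable_comp; last exact: differentiable_horner.
    by apply: differentiableM => //; exact: differentiable_cst.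
- rewrite disc_ofK ?normr0 ?ltr01 // /h /G !mulr0 addr0 F0; exact: mkXK.
- rewrite disc_ofK; last by rewrite normc_real gtr0_norm // ltcR.
  by rewrite /h /G divfK // mulVf // F1 addrC subrK mkXK.
Qed.

Lemma poincare_dist_ge0 (a b : unit_disc R) : 0 <= poincare_dist a b.
Proof.
rewrite /poincare_dist; set r := complex.Re _.
have r0 : 0 <= r by rewrite /r normc_def /= sqrtr_ge0.
(* For [r >= 1] the argument of [ln] is nonpositive, division by zero giving 0, and [ln] takes the
   value 0 there. *)
have [r1|r1] := ltP r 1; last first.
  rewrite ln0 // mulr_ge0_le0 ?invr_le0 ?subr_le0 //; lra.
by apply: ln_ge0; rewrite ler_pdivlMr ?subr_gt0 //; lra.
Qed.

Lemma poincare_dist0 (s : R) : 0 <= s < 1 ->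
  poincare_dist (disc_of 0) (disc_of s%:C) = ln ((1 + s) / (1 - s)).
Proof.
move=> /andP[s0 s1].
have s1' : `|s%:C| < 1 :> C by rewrite normc_real ger0_norm // ltcR.
have s2' : `|0 : C| < 1 by rewrite normr0 ltr01.
rewrite /poincare_dist (disc_ofK s1') (disc_ofK s2').
by rewrite conjc0 mul0r subr0 divr1 sub0r normrN normc_real ger0_norm.
Qed.

Lemma kobayashi_ge0 n (Y : charted R n) (p q : Y) : (0 <= kobayashi p q)%E.
Proof.
apply: le_ereal_inf_tmp => _ [k [P [a [b [f [_ ->]]]]]].
by rewrite lee_fin sumr_ge0 // => i _; exact: poincare_dist_ge0.
Qed.

Lemma kobayashi_le_disc n (Y : charted R n) (f : unit_disc R -> Y) a b :
  holomorphic f -> (kobayashi (f a) (f b) <= (poincare_dist a b)%:E)%E.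
Proof.
move=> hf; apply: ereal_inf_lbound.
exists 1%N, (fun i => if i is 0 then f a else f b), (fun=> a), (fun=> b).
exists (fun=> f).
by split; [split=> // -[]|rewrite big_ord_recl big_ord0 addr0].
Qed.

Lemma kobayashi_quotient (p q : quotient_manifold mu) : kobayashi p q = 0%E.
Proof.
have [x <-] := proj_surj p; have [y <-] := proj_surj q.
apply/eqP; rewrite eq_le kobayashi_ge0 andbT; apply/lee_addgt0Pr => e e0.
rewrite add0e; pose E := expR e.
have E1 : 1 < E by rewrite /E expR_gt1.
(* The solution of [(1 + s) / (1 - s) = expR e]: the points 0 and [s] of the disc are at Poincare
   distance exactly [e]. *)
pose s := (E - 1) / (E + 1).
have s0 : 0 < s by rewrite divr_gt0; lra.
have s1 : s < 1 by rewrite ltr_pdivrMr; lra.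
have sE : (1 + s) / (1 - s) = E.
  by rewrite /s; field; apply/andP; split; apply/eqP; lra.
have [w wE] := orbit_dense x y (mulr_gt0 s0 (zpart_gt0 x)).
have s01 : 0 < s < 1 by rewrite s0.
have [f [hf <- fs]] := disc_through s01 wE.
(* In the quotient [y] may be replaced by [mu w y], which the disc [f] reaches at [s]. *)
rewrite -(proj_act mu w y) -fs.
have hpf : holomorphic (quotient_proj mu \o f : _ -> quotient_manifold mu).
  apply: holomorphic_proj => //; first exact: HxSL2_complex_manifold.
    exact: F2_action_holomorphic.
  exact: unit_disc_homeo.
apply: le_trans (kobayashi_le_disc (disc_of 0) (disc_of s%:C) hpf) _.
by rewrite poincare_dist0 ?(ltW s0) // sE expRK.
Qed.

End action.

Theorem theorem3p1 (R : realType) :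
  complex_manifold (HxSL2 R) /\
  exists mu : group_action F2 (HxSL2 R),
    [/\ forall g : F2, biholomorphic (mu g),
        free_action mu,
        properly_discontinuous mu,
        complex_manifold (quotient_manifold mu) &
        forall p q : quotient_manifold mu, kobayashi p q = 0%E].
Proof.
split; first exact: HxSL2_complex_manifold.
exists (F2_action R); split.
- exact: F2_action_biholomorphic.
- exact: F2_action_free.
- exact: F2_action_properly_discontinuous.
- apply: quotient_complex_manifold; first exact: HxSL2_complex_manifold.
  + exact: F2_action_holomorphic.
  + exact: F2_action_separated.
  + exact: F2_action_free.
- exact: kobayashi_quotient.
Qed.
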